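(* Let $\alpha \in \mathbb{R}$, $\alpha \neq 0$. Each rectangle $\mathcal{R}\subset\mathbb{R}^2$ is determined up to congruence, among rectangles, by its first two Robin eigenvalues $\lambda_1(\mathcal{R};\alpha)$ and $\lambda_2(\mathcal{R};\alpha)$. That is, if $\mathcal{R}$ and $\mathcal{R}'$ are rectangles with $\lambda_1(\mathcal{R};\alpha)=\lambda_1(\mathcal{R}';\alpha)$ and $\lambda_2(\mathcal{R};\alpha)=\lambda_2(\mathcal{R}';\alpha)$, then $\mathcal{R}$ and $\mathcal{R}'$ are congruent.
   Context: Rectangles are (up to rotation) products of two bounded nonempty open intervals. For a bounded Lipschitz domain $\Omega \subset \mathbb{R}^2$ and $\alpha \in \mathbb{R}$, the Robin eigenvalues $\lambda_1(\Omega;\alpha) < \lambda_2(\Omega;\alpha) \leq \dots$ are the eigenvalues, counted with multiplicity, of $-\Delta u = \lambda u$ in $\Omega$ with $\partial u/\partial \nu + \alpha u = 0$ on $\partial \Omega$ ($\nu$ the outward unit normal). Equivalently $$\lambda_k(\Omega;\alpha) = \min_{U_k} \max_{u \in U_k \setminus \{0\}} \frac{\int_\Omega |\nabla u|^2\,dx + \alpha \int_{\partial\Omega} u^2\,dS}{\int_\Omega u^2\,dx},$$ where $U_k$ ranges over $k$-dimensional subspaces of $H^1(\Omega)$. *)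

(* Defs.v *)
From HB Require Import structures.
From mathcomp Require Import all_boot all_order all_algebra.
From mathcomp Require Import all_classical all_reals all_analysis.

Set Implicit Arguments.
Unset Strict Implicit.
Unset Printing Implicit Defensive.

Import Order.TTheory GRing.Theory Num.Theory.
Import numFieldNormedType.Exports.

Local Open Scope classical_set_scope.
Local Open Scope ring_scope.

Notation plane R := (R * R)%type.

Definition lebesgue2 (R : realType) :
    {measure set (measurableTypeR R * measurableTypeR R) -> \bar R} :=
  (@lebesgue_measure R \x @lebesgue_measure R)%E.

Section Euclidean_plane.
Variable R : realType.
Implicit Types (p q : plane R) (A B : set (plane R)).

(* The norm of the product [normedModType] is the sup norm, hence the explicit
   Euclidean distance. *)
Definition edist p q : R :=
  Num.sqrt ((p.1 - q.1) ^+ 2 + (p.2 - q.2) ^+ 2).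

Definition congruent A B : Prop :=
  exists f : plane R -> plane R,
    (forall p q, edist (f p) (f q) = edist p q) /\ f @` A = B.

Definition rotation (theta : R) p : plane R :=
  (cos theta * p.1 - sin theta * p.2, sin theta * p.1 + cos theta * p.2).

End Euclidean_plane.

Section Differentiability.
Variable R : realType.
Implicit Types f : plane R -> R.

Definition pd1 f (p : plane R) : R := 'D_((1, 0) : plane R) f p.
Definition pd2 f (p : plane R) : R := 'D_((0, 1) : plane R) f p.

Fixpoint Ck (n : nat) f : Prop :=
  match n with
  | 0%N => continuous f
  | m.+1 => [/\ continuous f,
      (forall p, derivable f p ((1, 0) : plane R)) /\ Ck m (pd1 f) &
      (forall p, derivable f p ((0, 1) : plane R)) /\ Ck m (pd2 f)]
  end.

Definition test_function (Omega : set (plane R)) f : Prop :=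
  [/\ forall n, Ck n f,
      compact (closure [set p | f p != 0]) &
      closure [set p | f p != 0] `<=` Omega].

End Differentiability.

Section L2.
Context d (T : measurableType d) (R : realType).

Definition L2 (mu : {measure set T -> \bar R}) (D : set T) (f : T -> R) : Prop :=
  measurable_fun D f /\ mu.-integrable D (fun x => (f x ^+ 2)%:E).

End L2.

Record rectangle (R : realType) := Rectangle {
  rleft : R; rright : R; rbottom : R; rtop : R; rangle : R;
  rleft_lt_rright : rleft < rright;
  rbottom_lt_rtop : rbottom < rtop }.

Section Rectangle.
Variable (R : realType) (Q : rectangle R).

Definition rect_set : set (plane R) :=
  rotation (rangle Q) @`
    (`]rleft Q, rright Q[%classic `*` `]rbottom Q, rtop Q[%classic).

(* The four edges are indexed by [e : bool * bool]: [e.1] tells whether the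
   first coordinate varies along the edge (before rotation), and [e.2] selects
   one of the two parallel edges.  Each one is parametrized by arc length, so
   that [rect_boundary_integral] is the integral against the surface measure
   of the boundary. *)
Definition edge_range (e : bool * bool) : set R :=
  if e.1 then `[rleft Q, rright Q]%classic
  else `[rbottom Q, rtop Q]%classic.

Definition edge (e : bool * bool) (s : R) : plane R :=
  rotation (rangle Q)
    (if e.1 then (s, if e.2 then rtop Q else rbottom Q)
     else (if e.2 then rright Q else rleft Q, s)).

Definition rect_boundary_integral (f : plane R -> \bar R) : \bar R :=
  (\sum_(e : bool * bool)
     \int[@lebesgue_measure R]_(s in edge_range e) f (edge e s))%E.

Definition boundary_L2 (f : plane R -> R) : Prop :=
  forall e : bool * bool,
    L2 (@lebesgue_measure R) (edge_range e) (fun s => f (edge e s)).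

Definition weak_gradient (u u1 u2 : plane R -> R) : Prop :=
  forall phi, test_function rect_set phi ->
    (\int[@lebesgue2 R]_(p in rect_set) (u p * pd1 phi p)%:E =
     - \int[@lebesgue2 R]_(p in rect_set) (u1 p * phi p)%:E)%E /\
    (\int[@lebesgue2 R]_(p in rect_set) (u p * pd2 phi p)%:E =
     - \int[@lebesgue2 R]_(p in rect_set) (u2 p * phi p)%:E)%E.

Definition L2_dist2 (f g : plane R -> R) : \bar R :=
  (\int[@lebesgue2 R]_(p in rect_set) ((f p - g p) ^+ 2)%:E)%E.

(* The trace operator is the continuous extension to H^1 of the restriction to
   the boundary of functions that are C^1 up to the boundary. *)
Definition is_trace (u u1 u2 t : plane R -> R) : Prop :=
  exists phi : nat -> plane R -> R,
    [/\ forall n, Ck 1 (phi n),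
        L2_dist2 (phi n) u @[n --> \oo] --> 0%E,
        L2_dist2 (pd1 (phi n)) u1 @[n --> \oo] --> 0%E,
        L2_dist2 (pd2 (phi n)) u2 @[n --> \oo] --> 0%E &
        rect_boundary_integral (fun p => ((phi n p - t p) ^+ 2)%:E)
          @[n --> \oo] --> 0%E].

(* An element of H^1, bundled with representatives of its weak gradient and of
   its trace, both of which it determines up to null sets.  Only the values of
   [h1_fun], [h1_d1], [h1_d2] on [rect_set], and those of [h1_trace] on the
   edges, are relevant. *)
Record H1 := MkH1 {
  h1_fun : plane R -> R;
  h1_d1 : plane R -> R;
  h1_d2 : plane R -> R;
  h1_trace : plane R -> R;
  h1_fun_L2 : L2 (@lebesgue2 R) rect_set h1_fun;
  h1_d1_L2 : L2 (@lebesgue2 R) rect_set h1_d1;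
  h1_d2_L2 : L2 (@lebesgue2 R) rect_set h1_d2;
  h1_trace_L2 : boundary_L2 h1_trace;
  h1_weak_gradient : weak_gradient h1_fun h1_d1 h1_d2;
  h1_is_trace : is_trace h1_fun h1_d1 h1_d2 h1_trace }.

Definition lincomb (k : nat) (c : 'rV[R]_k) (f : 'I_k -> plane R -> R)
  (p : plane R) : R := \sum_(i < k) c 0 i * f i p.

(* Linear independence in H^1, where functions equal almost everywhere are
   identified. *)
Definition H1_free (k : nat) (U : 'I_k -> H1) : Prop :=
  forall c : 'rV[R]_k,
    {ae @lebesgue2 R, forall p, rect_set p ->
       lincomb c (fun i => h1_fun (U i)) p = 0} -> c = 0.

(* The value at the combination [c] of the basis [U]; the weak gradient and the
   trace are linear in the function. *)
Definition rayleigh (alpha : R) (k : nat) (U : 'I_k -> H1) (c : 'rV[R]_k) : R :=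
  (fine (\int[@lebesgue2 R]_(p in rect_set)
     (lincomb c (fun i => h1_d1 (U i)) p ^+ 2 +
      lincomb c (fun i => h1_d2 (U i)) p ^+ 2)%:E)%E +
   alpha * fine (rect_boundary_integral
     (fun p => (lincomb c (fun i => h1_trace (U i)) p ^+ 2)%:E))) /
  fine (\int[@lebesgue2 R]_(p in rect_set)
     (lincomb c (fun i => h1_fun (U i)) p ^+ 2)%:E)%E.

(* Min-max over the [k]-dimensional subspaces of H^1, each given by a basis;
   [k] starts at 1.  The minimum and maximum are attained; [ereal_inf] and
   [ereal_sup] make the definition total. *)
Definition robin_eigenvalue (alpha : R) (k : nat) : \bar R :=
  ereal_inf [set ereal_sup [set (rayleigh alpha U c)%:E |
                             c in [set c : 'rV[R]_k | c != 0]] |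
              U in [set U : 'I_k -> H1 | H1_free U]].

End Rectangle.

(* Main.v *)
Require Import Defs.
From HB Require Import structures.
From mathcomp Require Import all_boot all_order all_algebra.
From mathcomp Require Import all_classical all_reals all_analysis.
From mathcomp Require Import measurable_realfun ring lra.

Set Implicit Arguments.
Unset Strict Implicit.
Unset Printing Implicit Defensive.

Import Order.TTheory GRing.Theory Num.Theory.
Import numFieldNormedType.Exports.

Local Open Scope classical_set_scope.
Local Open Scope ring_scope.

(** An interval of half-length [c] has Robin eigenvalues [mu c < nu c < ...].
   Separating variables, a rectangle with half-sides [c] and [d] has
   [lambda_1 = mu c + mu d], and its second eigenvalue is obtained by exciting
   the cheaper of the two variables:
   [lambda_2 - lambda_1 = min (nu c - mu c) (nu d - mu d)]
   ([rectangle_eigenvalues]).  The gap [nu - mu] is strictly decreasing in the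
   length ([gap_lt]), so that [lambda_2 - lambda_1] is the gap of the longer side
   and determines it; since [alpha != 0], [mu] is strictly monotone
   ([even_mode_lt]), so that [lambda_1] then determines the shorter side
   ([sides_determined]).

   In one dimension, the two modes are elementary functions (cosine or
   hyperbolic cosine; sine, identity or hyperbolic sine), but apart from their
   existence only the equation [X'' = - mu X], their parity and their positivity
   are used: every comparison between two lengths is a Sturm argument, in which
   the sign of a Wronskian at the end of the shorter interval contradicts the
   sign of its derivative.  For [alpha < 0] the gap decreases because [nu]
   decreases and [mu] increases.  For [alpha > 0] both decrease, and the
   comparison is made between the quotients of the second mode by the first.

   The upper bounds for [lambda_1] and [lambda_2] come from the products of
   modes.  For the lower bounds, let [f] be of class [C^1] on an interval and
   let [h] be [f] minus the multiple of the first mode [X] that makes [h] vanish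
   at the midpoint.  Away from the midpoint, where the second mode [Y] vanishes,
   [f'^2 - mu f^2 - (nu - mu) h^2 = (h' - Y' h / Y)^2 + G'] for an explicit [G]
   that absorbs the boundary terms, so the quadratic form of the interval,
   shifted by [mu], is at least [(nu - mu)] times the squared norm of the part of
   [f] orthogonal to [X] ([robin_gap_inequality]).  Integrating this in each
   variable over the rectangle leaves the commuting projections [P], [P'] onto
   the first modes in the two variables, and
   [|(1 - P) u|^2 + |(1 - P') u|^2 >= |(1 - P P') u|^2]
   ([projections_inequality]) gives the gap of the rectangle
   ([rect_form_lower]).  This is proved for functions of class [C^1] on the
   plane; by the definition of the trace these approximate every element of
   [H^1] together with its gradient and its trace, and all the terms pass to the
   limit ([rect_lower_H1]).  Rectangles in general position are reduced to
   products of intervals by the invariance of the area under rotations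
   ([area_preserving_rotation]) and by the chain rule ([C1_line]). *)

(** * Derivatives of real functions *)

Section Calculus.
Variable R : realType.
Implicit Types (f g df dg : R -> R) (x y a b : R).

Lemma der_eq f x d d' : is_derive x 1 f d -> d = d' -> is_derive x 1 f d'.
Proof. by move=> fd <-. Qed.

Lemma derC x (k : R) : is_derive x 1 (fun _ : R => k) 0.
Proof. exact: is_derive_cst. Qed.

Lemma derX x : is_derive x 1 (fun y : R => y) 1.
Proof. exact: is_derive_id. Qed.

Lemma derD f g x d e : is_derive x 1 f d -> is_derive x 1 g e ->
  is_derive x 1 (fun y => f y + g y) (d + e).
Proof. by move=> ? ?; exact: is_deriveD. Qed.

Lemma derN f x d : is_derive x 1 f d -> is_derive x 1 (fun y => - f y) (- d).
Proof. by move=> ?; exact: is_deriveN. Qed.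

Lemma derM f g x d e : is_derive x 1 f d -> is_derive x 1 g e ->
  is_derive x 1 (fun y => f y * g y) (d * g x + f x * e).
Proof.
move=> fd ge; have := @is_deriveM R _ f g x 1 d e fd ge.
by move/der_eq; apply; rewrite /GRing.scale/= addrC mulrC.
Qed.

Lemma derXn f n x d : is_derive x 1 f d ->
  is_derive x 1 (fun y => f y ^+ n.+1) (n.+1%:R * f x ^+ n * d).
Proof. by move=> fd; rewrite -exprfctE; exact: is_deriveX. Qed.

Lemma derV f x d : is_derive x 1 f d -> f x != 0 ->
  is_derive x 1 (fun y => (f y)^-1) (- (f x) ^- 2 * d).
Proof. by move=> fd fx0; exact: is_deriveV. Qed.

Lemma der_comp f g x d e : is_derive x 1 g e -> is_derive (g x) 1 f d ->
  is_derive x 1 (fun y => f (g y)) (d * e).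
Proof. by move=> ? ?; exact: (@is_derive1_comp _ f g). Qed.

Lemma der_cont f x d : is_derive x 1 f d -> {for x, continuous f}.
Proof.
by move=> [+ _] => /derivable1_diffP/differentiable_continuous.
Qed.
End Calculus.

(** The subterms [f], [g] are captured as functions, as the unifier does not
   find them. *)
Ltac der_step :=
  lazymatch goal with
  | |- is_derive _ _ (fun y => @?f y + @?g y) _ => eapply (@derD _ f g)
  | |- is_derive _ _ (fun y => - @?f y) _ => eapply (@derN _ f)
  | |- is_derive _ _ (fun y => @?f y * @?g y) _ => eapply (@derM _ f g)
  | |- is_derive _ _ (fun y => @?f y ^+ ?n.+1) _ => eapply (@derXn _ f n)
  | |- is_derive _ _ (fun y => (@?f y)^-1) _ => eapply (@derV _ f)
  | |- is_derive _ _ (fun y => y) _ => eapply derX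
  | |- is_derive _ _ (fun _ => ?k) _ => eapply derC
  | |- is_derive _ _ (fun y => ?f (@?g y)) _ => eapply (@der_comp _ f g)
  end; cbv beta.

Tactic Notation "derive_by" tactic3(tac) :=
  eapply der_eq; [repeat (first [tac | der_step]) | ].

Section Monotone.
Variable R : realType.
Implicit Types (f df : R -> R) (a b : R).

Lemma ler_der f df a b : a <= b ->
  {within `[a, b], continuous f} ->
  (forall x : R, x \in `]a, b[ -> is_derive x 1 f (df x)) ->
  (forall x : R, x \in `]a, b[ -> 0 <= df x) -> f a <= f b.
Proof.
rewrite le_eqVlt => /predU1P[->//|ab] cf fdf df0.
have [c cab e] := MVT ab fdf cf.
by rewrite -subr_ge0 e mulr_ge0 ?df0// subr_ge0 ltW.
Qed.

Lemma der_within f df (A : set R) : (forall x : R, is_derive x 1 f (df x)) ->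
  {within A, continuous f}.
Proof. by move=> fdf; apply: continuous_subspaceT => x; exact: der_cont. Qed.

Lemma ler_derT f df a b : a <= b ->
  (forall x : R, is_derive x 1 f (df x)) ->
  (forall x : R, x \in `]a, b[ -> 0 <= df x) -> f a <= f b.
Proof. by move=> ab fdf; apply: ler_der => //; exact: der_within. Qed.

Lemma ltr_der f df a b : a < b ->
  (forall x : R, is_derive x 1 f (df x)) ->
  (forall x : R, x \in `]a, b[ -> 0 < df x) -> f a < f b.
Proof.
move=> ab fdf df0.
have [c cab e] := MVT ab (fun x _ => fdf x) (der_within (A := _) fdf).
by rewrite -subr_gt0 e mulr_gt0 ?df0// subr_gt0.
Qed.

Lemma der0_cst f a b : (forall x : R, is_derive x 1 f 0) -> f a = f b.
Proof.
move=> f0; wlog ab : a b / a < b => [h|].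
  by have [/h//|/h//|->] := ltgtP a b.
have [c _ e] := MVT ab (fun x _ => f0 x) (der_within (A := _) f0).
by apply/eqP; rewrite eq_sym -subr_eq0 e mul0r.
Qed.

End Monotone.

(** * Robin modes of an interval and Sturm comparison *)

Section Modes.
Variable R : realType.
Implicit Types (alpha c mu nu : R) (X dX Y dY : R -> R).

(** Solutions of [X'' = - mu X]; carrying [X'] along avoids iterated derivation
   operators. *)
Record helmholtz mu X dX : Prop := Helmholtz {
  hz_d : forall x : R, is_derive x 1 X (dX x);
  hz_dd : forall x : R, is_derive x 1 dX (- mu * X x) }.

(** The first eigenfunction of the interval of half-length [c] centred at the
   origin; by parity, the condition at [- c] is the one at [c]. *)
Record even_mode alpha c mu X dX : Prop := EvenMode {
  even_hz : helmholtz mu X dX;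
  evenX : forall x : R, X (- x) = X x;
  even_dX : forall x : R, dX (- x) = - dX x;
  even_gt0 : forall x : R, 0 <= x <= c -> 0 < X x;
  even_robin : dX c = - alpha * X c }.

(** The second eigenfunction of the same interval. *)
Record odd_mode alpha c mu X dX : Prop := OddMode {
  odd_hz : helmholtz mu X dX;
  oddX : forall x : R, X (- x) = - X x;
  odd_dX : forall x : R, dX (- x) = dX x;
  odd_gt0 : forall x : R, 0 < x <= c -> 0 < X x;
  odd_slope : 0 < dX 0;
  odd_robin : dX c = - alpha * X c }.

Lemma helmholtz_energy mu X dX : helmholtz mu X dX -> forall x : R,
  mu * X x ^+ 2 + dX x ^+ 2 = mu * X 0 ^+ 2 + dX 0 ^+ 2.
Proof.
move=> [d1 d2] x; apply: (der0_cst (f := fun y => mu * X y ^+ 2 + dX y ^+ 2)) => y.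
by derive_by (first [exact: d1|exact: d2]); ring.
Qed.

(** All the comparisons of two lengths below integrate this identity. *)
Lemma helmholtz_wronskian mu nu X dX Y dY :
  helmholtz mu X dX -> helmholtz nu Y dY -> forall x : R,
  is_derive x 1 (fun y => dY y * X y - Y y * dX y) ((mu - nu) * (X x * Y x)).
Proof.
move=> [d1 d2] [e1 e2] x.
by derive_by (first [exact: d1|exact: d2|exact: e1|exact: e2]); ring.
Qed.

Lemma even_mode_dX0 alpha c mu X dX : even_mode alpha c mu X dX -> dX 0 = 0.
Proof. by move=> /even_dX/(_ 0); rewrite oppr0 => ?; lra. Qed.

Lemma odd_mode_X0 alpha c mu X dX : odd_mode alpha c mu X dX -> X 0 = 0.
Proof. by move=> /oddX/(_ 0); rewrite oppr0 => ?; lra. Qed.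

(** The derivative of [X' / X] is [- e / X ^ 2], where [e] is the conserved
   energy; as [X' / X] equals [- alpha] at the Robin endpoint [c], its position
   relative to [- alpha] at an earlier point is given by the sign of [e].  At the
   end of a shorter interval, this is the sign of the boundary term of the
   Wronskian. *)
Lemma robin_defect alpha c mu X dX x : helmholtz mu X dX -> x < c ->
  (forall y : R, x <= y <= c -> 0 < X y) -> dX c = - alpha * X c ->
  0 < (mu * X 0 ^+ 2 + dX 0 ^+ 2) * (dX x + alpha * X x) \/
  mu * X 0 ^+ 2 + dX 0 ^+ 2 = 0.
Proof.
move=> hz xc X0 rob; set e := mu * X 0 ^+ 2 + dX 0 ^+ 2.
have [->|e0] := eqVneq e 0; [by right|left].
pose r y := dX y / X y.
have dr y : x <= y <= c -> is_derive y 1 r (- e / X y ^+ 2).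
  move=> /X0/lt0r_neq0 Xy; rewrite /r.
  derive_by (first [exact: (hz_d hz)|exact: (hz_dd hz)|exact: Xy]).
  by rewrite /e -(helmholtz_energy hz y); field.
have [y yxc] : exists2 y, y \in `]x, c[ & r c - r x = (- e / X y ^+ 2) * (c - x).
  apply: MVT => // [y /[!in_itv]/= /andP[xy yc]|].
    by apply: dr; rewrite !ltW.
  apply/continuous_in_subspaceT => y /[!inE]/= /[!in_itv]/= yxc.
  by apply: der_cont; exact: dr.
move: yxc; rewrite in_itv/= => /andP[xy yc].
have Xy : 0 < X y by rewrite X0// !ltW.
have Xx : 0 < X x by rewrite X0// lexx ltW.
have Xc : 0 < X c by rewrite X0// lexx ltW.
have -> : r c = - alpha by rewrite /r rob mulfK// gt_eqF.
have -> : dX x + alpha * X x = (r x + alpha) * X x.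
  by rewrite /r; field; rewrite gt_eqF.
rewrite mulrA => h; apply: mulr_gt0 => //.
have -> : r x + alpha = e / X y ^+ 2 * (c - x) by lra.
rewrite mulrA mulr_gt0 ?subr_gt0// mulrA divr_gt0 ?exprn_gt0//.
by rewrite -expr2 exprn_even_gt0.
Qed.

(** With the opposite sign of [mu], the concavity of [X] would give [X'] at [c] the
   wrong sign, as [X'] vanishes at the origin. *)
Lemma even_mode_mu_sign alpha c mu X dX : 0 < c -> even_mode alpha c mu X dX ->
  (0 < alpha -> 0 < mu) /\ (alpha < 0 -> mu < 0).
Proof.
move=> c0 m; have dX0 := even_mode_dX0 m; case: m => hz _ _ X0 rob.
have Xc : 0 < X c by rewrite X0// lexx ltW.
split=> a0; rewrite ltNge; apply/negP => mu0.
- have : dX 0 <= dX c.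
    apply: (ler_derT (ltW c0) (hz_dd hz)) => x /[!in_itv]/= /andP[x0 xc].
    by rewrite mulr_ge0 ?oppr_ge0// ltW// X0// !ltW.
  by rewrite dX0 rob mulNr oppr_ge0 pmulr_rle0// leNgt Xc.
- have : - dX 0 <= - dX c.
    apply: (ler_derT (ltW c0) (fun x => derN (hz_dd hz x))) => x.
    rewrite in_itv/= => /andP[x0 xc].
    by rewrite mulNr opprK mulr_ge0// ltW// X0// !ltW.
  by rewrite dX0 rob mulNr opprK oppr0 nmulr_rge0// leNgt Xc.
Qed.

(** The energy of an odd mode is the square of its slope at the origin, hence
   positive whatever the sign of [alpha]. *)
Lemma odd_mode_lt alpha c c' mu X dX mu' X' dX' : 0 < c -> c < c' ->
  odd_mode alpha c mu X dX -> odd_mode alpha c' mu' X' dX' -> mu' < mu.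
Proof.
move=> c0 cc' m m'; have X0 := odd_mode_X0 m; have X'0 := odd_mode_X0 m'.
case: m m' => hz _ _ Xp _ rob [hz' _ _ X'p sl rob'].
rewrite ltNge; apply/negP => mumu'.
have Xc : 0 < X c by rewrite Xp// lexx c0.
have : - (dX' 0 * X 0 - X' 0 * dX 0) <= - (dX' c * X c - X' c * dX c).
  apply: (ler_derT (ltW c0)
    (fun x => derN (helmholtz_wronskian hz hz' x))) => x.
  rewrite in_itv/= => /andP[x0 xc].
  rewrite -mulNr opprB mulr_ge0 ?subr_ge0// mulr_ge0// ltW ?Xp ?X'p ?x0 ?ltW//.
  exact: lt_trans cc'.
rewrite X0 X'0 rob !(mulr0, mul0r) subrr oppr0.
have -> : dX' c * X c - X' c * (- alpha * X c) = (dX' c + alpha * X' c) * X c by ring.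
rewrite oppr_ge0 pmulr_lle0//.
have [|h|] := robin_defect (alpha := alpha) hz' cc' _ rob'.
- by move=> y /andP[cy yc']; rewrite X'p// yc' (lt_le_trans c0).
- apply/negP; rewrite -ltNge.
  by move: h; rewrite X'0 expr0n mulr0 add0r pmulr_rgt0// exprn_gt0.
- by rewrite X'0 expr0n mulr0 add0r => /eqP; rewrite sqrf_eq0 gt_eqF.
Qed.

(** The energy of an even mode has the sign of [mu], that is of [alpha], hence the
   two opposite monotonicities. *)
Lemma even_mode_lt alpha c c' mu X dX mu' X' dX' : 0 < c -> c < c' ->
  even_mode alpha c mu X dX -> even_mode alpha c' mu' X' dX' ->
  (0 < alpha -> mu' < mu) /\ (alpha < 0 -> mu < mu').
Proof.
move=> c0 cc' m m'; have X0 := even_mode_dX0 m; have X'0 := even_mode_dX0 m'.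
have [sp sn] := even_mode_mu_sign (lt_trans c0 cc') m'.
case: m m' => hz _ _ Xp rob [hz' _ _ X'p rob'].
have Xc : 0 < X c by rewrite Xp// lexx ltW.
have X'c0 : 0 < X' 0 by rewrite X'p// lexx ltW// (lt_trans c0).
have W0 : dX' 0 * X 0 - X' 0 * dX 0 = 0 by rewrite X0 X'0; ring.
have Wc : dX' c * X c - X' c * dX c = (dX' c + alpha * X' c) * X c by rewrite rob; ring.
have rd := robin_defect (alpha := alpha) hz' cc' _ rob'.
have {rd}[|rd|rd] := rd.
- by move=> y /andP[cy yc']; rewrite X'p// yc' (le_trans (ltW c0)).
- rewrite X'0 expr0n/= addr0 -mulrA in rd.
  split=> a0; rewrite ltNge; apply/negP => mumu'.
  + have : - (dX' 0 * X 0 - X' 0 * dX 0) <= - (dX' c * X c - X' c * dX c).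
      apply: (ler_derT (ltW c0)
        (fun x => derN (helmholtz_wronskian hz hz' x))) => x.
      rewrite in_itv/= => /andP[x0 xc].
      rewrite -mulNr opprB mulr_ge0 ?subr_ge0// mulr_ge0// ltW ?Xp ?X'p ?ltW//.
      exact: lt_trans cc'.
    rewrite W0 Wc oppr0 oppr_ge0 pmulr_lle0// leNgt.
    by move: rd; rewrite pmulr_rgt0 ?sp// pmulr_rgt0 ?exprn_gt0// => ->.
  + have : (dX' 0 * X 0 - X' 0 * dX 0) <= (dX' c * X c - X' c * dX c).
      apply: (ler_derT (ltW c0)
        (helmholtz_wronskian hz hz')) => x.
      rewrite in_itv/= => /andP[x0 xc].
      rewrite mulr_ge0 ?subr_ge0// mulr_ge0// ltW ?Xp ?X'p ?ltW//.
      exact: lt_trans cc'.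
    rewrite W0 Wc pmulr_lge0// leNgt.
    by move: rd; rewrite nmulr_rgt0 ?sn// pmulr_rlt0 ?exprn_gt0// => ->.
- rewrite X'0 expr0n/= addr0 in rd.
  have mu'0 : mu' = 0.
    by move/eqP: rd; rewrite mulf_eq0 sqrf_eq0 (gt_eqF X'c0) orbF => /eqP.
  by split=> [/sp|/sn]; rewrite mu'0 ltxx.
Qed.

(** The Wronskian of the two modes vanishes at [c] and is positive at the origin;
   its derivative has the sign of [mu - nu]. *)
Lemma mode_wronskian_gt0 alpha c mu X dX nu Y dY : 0 < c ->
  even_mode alpha c mu X dX -> odd_mode alpha c nu Y dY ->
  mu < nu /\ forall x : R, 0 <= x < c -> 0 < dY x * X x - Y x * dX x.
Proof.
move=> c0 m m'; have X0 := even_mode_dX0 m; have Y0 := odd_mode_X0 m'.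
case: m m' => hz _ _ Xp rob [hz' _ _ Yp sl rob'].
have W0 : 0 < dY 0 * X 0 - Y 0 * dX 0.
  by rewrite Y0 mul0r subr0 mulr_gt0// Xp// lexx ltW.
have Wc : dY c * X c - Y c * dX c = 0 by rewrite rob rob'; ring.
have munu : mu < nu.
  rewrite ltNge; apply/negP => numu.
  have : (dY 0 * X 0 - Y 0 * dX 0) <= (dY c * X c - Y c * dX c).
    apply: (ler_derT (ltW c0) (helmholtz_wronskian hz hz')) => x.
    rewrite in_itv/= => /andP[x0 xc].
    by rewrite mulr_ge0 ?subr_ge0// mulr_ge0// ltW ?Xp ?Yp ?x0 ?ltW.
  by rewrite Wc leNgt W0.
split=> // x /andP[x0 xc]; rewrite -Wc -ltrN2.
apply: (ltr_der xc (fun x => derN (helmholtz_wronskian hz hz' x))) => y.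
rewrite in_itv/= => /andP[xy yc].
have y0 : 0 < y by exact: le_lt_trans xy.
by rewrite -mulNr opprB mulr_gt0 ?subr_gt0// mulr_gt0 ?Xp ?Yp ?y0 ?ltW.
Qed.

(** If [alpha > 0], both eigenvalues decrease with the length.  The quotient
   [w = Y / X] satisfies [(X ^ 2 w')' = - (nu - mu) X ^ 2 w], vanishes at the origin
   and has [w' = 0] at [c]: the gap is the first eigenvalue of a problem with
   weight [X ^ 2].  Let [W = Y' / X'] be the quotient for the longer interval.  By
   [V], [X' / X] is nondecreasing, so that if the gap did not decrease,
   [E = X' ^ 2 (W_x w - W w_x)] would be nonincreasing, whereas it vanishes at the
   origin and is positive at [c].  (Primes refer to the longer interval,
   subscripts to derivatives.) *)
Lemma gap_lt alpha c c' mu X dX nu Y dY mu' X' dX' nu' Y' dY' :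
  alpha != 0 -> 0 < c -> c < c' ->
  even_mode alpha c mu X dX -> odd_mode alpha c nu Y dY ->
  even_mode alpha c' mu' X' dX' -> odd_mode alpha c' nu' Y' dY' ->
  nu' - mu' < nu - mu.
Proof.
move=> a0 c0 cc' mX mY mX' mY'.
have c'0 := lt_trans c0 cc'.
have [evp evn] := even_mode_lt c0 cc' mX mX'.
have od := odd_mode_lt c0 cc' mY mY'.
have [/evn ?|ap|/eqP] := ltgtP alpha 0; [lra| |by rewrite (negbTE a0)].
have {evn}mu'mu := evp ap.
rewrite ltNge; apply/negP => gg.
have [_ W] := mode_wronskian_gt0 c0 mX mY.
have [_ W'] := mode_wronskian_gt0 c'0 mX' mY'.
have X0 := even_mode_dX0 mX; have Y0 := odd_mode_X0 mY.
have X'0 := even_mode_dX0 mX'; have Y'0 := odd_mode_X0 mY'.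
case: mX mY mX' mY' => hX _ _ Xp rX [hY _ _ Yp _ rY].
move=> [hX' _ _ X'p _] [hY' _ _ Y'p _ _].
have V x : 0 <= x <= c -> 0 <= dX' x * X x - X' x * dX x.
  move=> /andP[x0 xc].
  have -> : 0 = dX' 0 * X 0 - X' 0 * dX 0 by rewrite X0 X'0; ring.
  apply: (@ler_derT _ _ _ 0 x x0 (helmholtz_wronskian hX hX')) => y.
  rewrite in_itv/= => /andP[y0 yx].
  have yc : y < c by exact: lt_le_trans xc.
  rewrite mulr_ge0 ?subr_ge0 ?ltW// mulr_gt0 ?Xp ?X'p ?(ltW y0) ?ltW//.
  exact: lt_trans cc'.
pose E x := (dY' x * X' x - Y' x * dX' x) * Y x / X x
  - (dY x * X x - Y x * dX x) * Y' x * X' x / X x ^+ 2.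
pose dE x := - ((nu' - mu') - (nu - mu)) * (X' x * Y' x * Y x / X x)
  - 2 * (dY x * X x - Y x * dX x) * Y' x / X x ^+ 3 * (dX' x * X x - X' x * dX x).
have Ed x : 0 <= x <= c -> is_derive x 1 (fun y => - E y) (- dE x).
  move=> /Xp/lt0r_neq0 Xx; rewrite /E.
  derive_by (first [exact: (hz_d hX)|exact: (hz_dd hX)
    |exact: (hz_d hY)|exact: (hz_dd hY)|exact: (hz_d hX')|exact: (hz_dd hX')
    |exact: (hz_d hY')|exact: (hz_dd hY')|exact: Xx|by rewrite expf_neq0]).
  by rewrite /dE; field.
have : - E 0 <= - E c.
  apply: (@ler_der _ (fun x => - E x) (fun x => - dE x) 0 c (ltW c0)) => [|x|x].
  - apply/continuous_in_subspaceT => y /[!inE]/= /[!in_itv]/= yxc.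
    by apply: der_cont; exact: Ed.
  - by rewrite in_itv/= => /andP[x0 xc]; apply: Ed; rewrite !ltW.
  - rewrite in_itv/= => /andP[x0 xc].
    have x0c : 0 <= x <= c by rewrite !ltW.
    have xc' : x <= c' by rewrite ltW// (lt_trans xc).
    have ? : 0 < X x by exact: Xp.
    have ? : 0 < X' x by rewrite X'p// ltW.
    have ? : 0 < Y x by rewrite Yp// x0 ltW.
    have ? : 0 < Y' x by rewrite Y'p// x0.
    rewrite /dE opprB mulNr opprK addr_ge0//.
      apply: mulr_ge0; last exact: V.
      by rewrite !mulr_ge0 ?invr_ge0 ?exprn_ge0 ?ltW// W// ltW.
    by rewrite mulr_ge0 ?subr_ge0// !mulr_ge0 ?invr_ge0// ltW.
rewrite /E Y0 Y'0 rX rY !(mulr0, mul0r) subrr oppr0 oppr_ge0.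
have -> : - alpha * Y c * X c - Y c * (- alpha * X c) = 0 by ring.
rewrite !mul0r subr0; apply/negP; rewrite -ltNge.
by rewrite divr_gt0 ?Xp ?lexx ?ltW// mulr_gt0 ?Yp ?lexx ?c0// W'// cc' ltW.
Qed.

End Modes.

(** * Existence of the modes *)

Section ModeExistence.
Variable R : realType.
Implicit Types (alpha c mu nu y : R) (X dX Y dY : R -> R).

Lemma root_between (g : R -> R) (a b : R) : a < b ->
  (forall x : R, exists d, is_derive x 1 g d) -> g a * g b < 0 ->
  exists y, [/\ a < y, y < b & g y = 0].
Proof.
move=> ab gd gab.
have [y] : exists2 y, y \in `[a, b] & g y = 0.
  apply: IVT; [exact: ltW| |].
    by apply: continuous_subspaceT => x; have [d] := gd x; exact: der_cont.
  rewrite ge_min le_max; move: gab.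
  have [ga|ga|->] := ltgtP (g a) 0; last by rewrite mul0r ltxx.
  - by rewrite nmulr_rlt0// => /ltW ->; rewrite orbT.
  - by rewrite pmulr_rlt0// => /ltW ->; rewrite orbT.
rewrite in_itv/= => /andP[ay yb] gy; exists y; split=> //.
- by rewrite lt_neqAle ay andbT; apply: contraTneq gab => ->; rewrite gy mul0r ltxx.
- by rewrite lt_neqAle yb andbT; apply: contraTneq gab => <-; rewrite gy mulr0 ltxx.
Qed.

(** For [k = y / c], the Robin condition for [cos (k x)] is
   [y sin y = alpha c cos y], which has a solution in the first quadrant; for
   [alpha < 0] the mode is [cosh (k x)]. *)
Lemma even_mode_exists alpha c : alpha != 0 -> 0 < c ->
  exists mu X dX, even_mode alpha c mu X dX.
Proof.
move=> a0 c0; have [an|ap|/eqP] := ltgtP alpha 0; last by rewrite (negbTE a0).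
- pose B := - alpha * c.
  have B0 : 0 < B by rewrite mulr_gt0// oppr_gt0.
  have [y [y0 _ gy]] : exists y, [/\ 0 < y, y < 2 * B + 1 &
      y * (expR y - expR (- y)) - B * (expR y + expR (- y)) = 0].
    apply: (@root_between (fun y => y * (expR y - expR (- y)) - B * (expR y + expR (- y)))).
    (* [2 B + 1] works since [exp y >= 1 + y] and [exp (- y) <= 1]. *)
    + lra.
    + by move=> x; eexists; derive_by (exact: is_derive_expR).
    + rewrite oppr0 expR0 pmulr_llt0; first by lra.
      have e1 := expR_ge1Dx (2 * B + 1).
      have : expR (- (2 * B + 1)) <= 1 by rewrite expR_le1; lra.
      have := expR_ge0 (- (2 * B + 1)).
      move: e1; set e := expR _; set e' := expR _ => e1 e'0 e'1.
      have : (B + 1) * (2 * B + 2) <= (B + 1) * e by rewrite ler_pM2l; lra.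
      have : (3 * B + 1) * e' <= (3 * B + 1) * 1 by rewrite ler_pM2l; lra.
      by have := sqr_ge0 B; nra.
  pose k := y / c.
  have k0 : 0 < k by rewrite divr_gt0.
  exists (- k ^+ 2), (fun x => expR (k * x) + expR (- (k * x))),
    (fun x => k * (expR (k * x) - expR (- (k * x)))); split.
  + split=> x; derive_by (exact: is_derive_expR); ring.
  + by move=> x; rewrite mulrN opprK addrC.
  + by move=> x; rewrite mulrN opprK; ring.
  + by move=> x _; rewrite addr_gt0// expR_gt0.
  + have -> : k * c = y by rewrite /k divfK// gt_eqF.
    apply: (@mulIf _ c); first by rewrite gt_eqF.
    rewrite /k; have -> : - alpha * (expR y + expR (- y)) * c = B * (expR y + expR (- y)).
      by rewrite /B; ring.
    rewrite mulrAC divfK ?gt_eqF//; lra.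
- pose B := alpha * c.
  have B0 : 0 < B by rewrite mulr_gt0.
  have p0 : 0 < pi / 2 :> R by rewrite divr_gt0// pi_gt0.
  have [y [y0 yp gy]] : exists y, [/\ 0 < y, y < pi / 2 & y * sin y - B * cos y = 0].
    apply: (@root_between (fun y => y * sin y - B * cos y)) => //.
    + by move=> x; eexists; derive_by (first [exact: is_derive_sin|exact: is_derive_cos]).
    + rewrite sin0 cos0 sin_pihalf cos_pihalf; nra.
  pose k := y / c.
  have k0 : 0 < k by rewrite divr_gt0.
  have kc : k * c = y by rewrite /k divfK// gt_eqF.
  exists (k ^+ 2), (fun x => cos (k * x)), (fun x => - (k * sin (k * x))); split.
  + by split=> x; derive_by (first [exact: is_derive_sin|exact: is_derive_cos]); ring.
  + by move=> x; rewrite mulrN cosN.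
  + by move=> x; rewrite mulrN sinN; ring.
  + move=> x /andP[x0 xc]; apply: cos_gt0_pihalf.
    have : 0 <= k * x by rewrite mulr_ge0// ltW.
    have : k * x <= y by rewrite -kc ler_pM2l.
    lra.
  + rewrite kc; apply: (@mulIf _ c); first by rewrite gt_eqF.
    have -> : - alpha * cos y * c = - (B * cos y) by rewrite /B; ring.
    have -> : - (k * sin y) * c = - (y * sin y) by rewrite -kc; ring.
    lra.
Qed.

Lemma sin_lt_id y : 0 < y -> y <= pi -> sin y < y.
Proof.
move=> y0 ypi; rewrite -subr_gt0.
have -> : 0 = 0 - sin 0 :> R by rewrite sin0 subr0.
apply: (@ltr_der _ (fun y => y - sin y) (fun y => 1 - cos y)) => // x.
move=> /[!in_itv]/= /andP[x0 xy]; rewrite subr_gt0 -cos0.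
by rewrite ltr_cos// in_itv/= ?lexx ?pi_ge0// ltW// ltW// (lt_le_trans xy).
Qed.

Lemma sinh_ge y : 0 <= y -> 2 * y <= expR y - expR (- y).
Proof.
move=> y0; rewrite -subr_ge0.
have -> : 0 = expR 0 - expR (- 0) - 2 * 0 :> R by rewrite oppr0 subrr mulr0 subr0.
apply: (@ler_derT _ (fun y => expR y - expR (- y) - 2 * y)
  (fun y => expR y + expR (- y) - 2)) => // x.
  by derive_by (exact: is_derive_expR); ring.
by have := expR_ge1Dx x; have := expR_ge1Dx (- x); lra.
Qed.

(** The second mode is [sin (k x)], [x] or [sinh (k x)] according to the sign of
   [1 + alpha c]. *)
Lemma odd_mode_exists alpha c : 0 < c ->
  exists mu X dX, odd_mode alpha c mu X dX.
Proof.
move=> c0; pose s := alpha * c.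
have [sn|sp|s1] := ltgtP s (-1).
(* The left end [ln (- s)] makes [cosh y < - s], while [2 y <= 2 sinh y]. *)
- have [y [y0 _ gy]] : exists y, [/\ ln (- s) < y, y < - s &
      y * (expR y + expR (- y)) + s * (expR y - expR (- y)) = 0].
    have s0 : 0 < - s by lra.
    apply: (@root_between (fun y => y * (expR y + expR (- y)) + s * (expR y - expR (- y)))).
    + exact: ln_sublinear.
    + by move=> x; eexists; derive_by (exact: is_derive_expR).
    + have l0 : 0 < ln (- s) by apply: ln_gt0; lra.
      rewrite pmulr_llt0; last first.
        by have := expR_gt0 (- - s); move: (expR _) (expR _) => e e' e0; nra.
      have := sinh_ge (ltW l0).
      rewrite expRN lnK//; set e := (- s)^-1.
      have : e < 1 by rewrite /e invf_lt1; lra.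
      by move: l0; set l := ln _; nra.
  have {y0} y0 : 0 < y by apply: lt_trans y0; apply: ln_gt0; lra.
  pose k := y / c.
  have k0 : 0 < k by rewrite divr_gt0.
  have kc : k * c = y by rewrite /k divfK// gt_eqF.
  exists (- k ^+ 2), (fun x => expR (k * x) - expR (- (k * x))),
    (fun x => k * (expR (k * x) + expR (- (k * x)))); split.
  + split=> x; derive_by (exact: is_derive_expR); ring.
  + by move=> x; rewrite mulrN opprK opprB.
  + by move=> x; rewrite mulrN opprK; ring.
  + by move=> x /andP[x0 xc]; rewrite subr_gt0 ltr_expR gtrN// mulr_gt0.
  + by rewrite mulr0 oppr0 expR0 mulr_gt0.
  + rewrite kc; apply: (@mulIf _ c); first by rewrite gt_eqF.
    have -> : - alpha * (expR y - expR (- y)) * c = - (s * (expR y - expR (- y))).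
      by rewrite /s; ring.
    rewrite mulrAC kc; lra.
- have [y [y0 yp gy]] : exists y, [/\ 0 < y, y < pi & y * cos y + s * sin y = 0].
    suff [z [z0 zp gz]] : exists z, [/\ 0 < z, z < pi & 0 < z * cos z + s * sin z].
      have [] := @root_between (fun y => y * cos y + s * sin y) z pi zp.
      + by move=> x; eexists; derive_by (first [exact: is_derive_sin|exact: is_derive_cos]).
      + by rewrite cospi sinpi mulr0 addr0 pmulr_rlt0// mulrN1 oppr_lt0 pi_gt0.
      + by move=> y [zy yp gy]; exists y; split=> //; exact: lt_trans zy.
    have [s0|s0] := ltP s 0.
    (* At [z = acos (- s)], the function is [- s (z - sin z)]. *)
    + have r1 : -1 <= - s <= 1 by lra.
      have a0 : 0 < acos (- s) by apply: acos_gt0; lra.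
      have ap : acos (- s) < pi by apply: acos_ltpi; lra.
      exists (acos (- s)); split=> //.
      rewrite acosK; last by rewrite in_itv/=.
      have := sin_lt_id a0 (ltW ap); nra.
    + have p2 : 2 <= pi :> R := pi_ge2 R.
      exists 1; split; [lra..|].
      have := cos1_gt0 R; have : 0 < sin 1 :> R by apply: sin2_gt0; lra.
      nra.
  pose k := y / c.
  have k0 : 0 < k by rewrite divr_gt0.
  have kc : k * c = y by rewrite /k divfK// gt_eqF.
  exists (k ^+ 2), (fun x => sin (k * x)), (fun x => k * cos (k * x)); split.
  + by split=> x; derive_by (first [exact: is_derive_sin|exact: is_derive_cos]); ring.
  + by move=> x; rewrite mulrN sinN.
  + by move=> x; rewrite mulrN cosN.
  + move=> x /andP[x0 xc]; apply: sin_gt0_pi.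
    rewrite mulr_gt0//=; apply: le_lt_trans yp.
    by rewrite -kc ler_pM2l.
  + by rewrite mulr0 cos0 mulr1.
  + rewrite kc; apply: (@mulIf _ c); first by rewrite gt_eqF.
    have -> : - alpha * sin y * c = - (s * sin y) by rewrite /s; ring.
    rewrite mulrAC kc; lra.
- exists 0, (fun x => x), (fun=> 1); split.
  + by split=> x; derive_by fail; ring.
  + by [].
  + by [].
  + by move=> x /andP[].
  + exact: ltr01.
  + by rewrite mulNr -/s s1 opprK.
Qed.

(** A choice of modes for all lengths, so that the eigenvalues become functions
   of the length. *)
Lemma robin_spectrum_interval alpha : alpha != 0 ->
  exists mu nu : R -> R, exists X dX Y dY : R -> R -> R,
    forall c, 0 < c -> even_mode alpha c (mu c) (X c) (dX c) /\
                       odd_mode alpha c (nu c) (Y c) (dY c).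
Proof.
move=> a0.
have /choice[F hF] : forall c, exists p : R * (R -> R) * (R -> R) * (R * (R -> R) * (R -> R)),
    0 < c -> even_mode alpha c p.1.1.1 p.1.1.2 p.1.2 /\
             odd_mode alpha c p.2.1.1 p.2.1.2 p.2.2.
  move=> c; have [c0|_] := ltP 0 c; last first.
    by exists (0, fun=> 0, fun=> 0, (0, fun=> 0, fun=> 0)).
  have [m [X [dX h]]] := even_mode_exists a0 c0.
  have [n [Y [dY h']]] := odd_mode_exists alpha c0.
  by exists (m, X, dX, (n, Y, dY)).
by exists (fun c => (F c).1.1.1), (fun c => (F c).2.1.1), (fun c => (F c).1.1.2),
  (fun c => (F c).1.2), (fun c => (F c).2.1.2), (fun c => (F c).2.2).
Qed.
End ModeExistence.

(** * Integrals of continuous functions *)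

Section Continuity.
Variable R : realType.
Implicit Types T U V : topologicalType.

Lemma ctsC T U (a : U) : continuous (fun _ : T => a).
Proof. exact: cst_continuous. Qed.

Lemma cts_id T : continuous (fun x : T => x).
Proof. by move=> x. Qed.

Lemma cts_comp T U V (f : T -> U) (g : U -> V) :
  continuous f -> continuous g -> continuous (fun x => g (f x)).
Proof. by move=> cf cg x; apply: continuous_comp; [exact: cf|exact: cg]. Qed.

Lemma cts_pair T U V (f : T -> U) (g : T -> V) :
  continuous f -> continuous g -> continuous (fun x => (f x, g x)).
Proof.
move=> cf cg x.
exact: (@cvg_pair _ _ _ _ (nbhs (f x)) (nbhs (g x)) _ _ _ f g (cf x) (cg x)).
Qed.

Lemma cts_fst T U V (f : T -> (U * V)%type) :
  continuous f -> continuous (fun x => (f x).1).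
Proof. by move=> cf; apply: (cts_comp cf) => -[x y]; exact: cvg_fst. Qed.

Lemma cts_snd T U V (f : T -> (U * V)%type) :
  continuous f -> continuous (fun x => (f x).2).
Proof. by move=> cf; apply: (cts_comp cf) => -[x y]; exact: cvg_snd. Qed.

Lemma ctsD T (f g : T -> R) :
  continuous f -> continuous g -> continuous (fun x => f x + g x).
Proof. by move=> cf cg x; apply: continuousD; [exact: cf|exact: cg]. Qed.

Lemma ctsN T (f : T -> R) : continuous f -> continuous (fun x => - f x).
Proof. by move=> cf x; apply: continuousN; exact: cf. Qed.

Lemma ctsM T (f g : T -> R) :
  continuous f -> continuous g -> continuous (fun x => f x * g x).
Proof. by move=> cf cg x; apply: continuousM; [exact: cf|exact: cg]. Qed.

Lemma ctsX T (f : T -> R) n : continuous f -> continuous (fun x => f x ^+ n).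
Proof.
move=> cf; elim: n => [|n ih]; first by under eq_fun do rewrite expr0; exact: ctsC.
by under eq_fun do rewrite exprS; exact: ctsM.
Qed.

End Continuity.

(** Compound functions are matched with hypotheses up to syntactic equality only:
   unfolding them is prohibitively slow. *)
Ltac cts_step :=
  first [match goal with H : continuous ?f |- continuous ?g =>
    constr_eq f g; exact H end |
  lazymatch goal with
  | |- continuous (fun _ => ?a) => eapply ctsC
  | |- continuous (fun y => y) => eapply cts_id
  | |- continuous (fun y => @?f y + @?g y) => eapply (@ctsD _ _ f g)
  | |- continuous (fun y => - @?f y) => eapply (@ctsN _ _ f)
  | |- continuous (fun y => @?f y * @?g y) => eapply (@ctsM _ _ f g)
  | |- continuous (fun y => @?f y ^+ ?n) => eapply (@ctsX _ _ f n)
  | |- continuous (fun y => (@?f y, @?g y)) => eapply (@cts_pair _ _ _ f g)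
  | |- continuous (fun y => (@?f y).1) => eapply (@cts_fst _ _ _ f)
  | |- continuous (fun y => (@?f y).2) => eapply (@cts_snd _ _ _ f)
  | |- continuous (fun y => ?f (@?g y)) => eapply (@cts_comp _ _ _ g f)
  | |- continuous _ => assumption
  end]; cbv beta.

Tactic Notation "cts" := repeat cts_step.

Section SegmentIntegral.
Variable R : realType.
Implicit Types (f g : R -> R) (l r x y : R).
Local Notation mu := (@lebesgue_measure R).

Definition segint l r f : R := (\int[mu]_(x in `[l, r]) f x)%R.

Lemma segint_integrable l r f : continuous f ->
  mu.-integrable `[l, r] (EFin \o f).
Proof.
move=> cf; apply: continuous_compact_integrable; first exact: segment_compact.
exact: continuous_subspaceT.
Qed.

Lemma segintE l r f : continuous f ->
  (\int[mu]_(x in `[l, r]) (f x)%:E)%E = (segint l r f)%:E.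
Proof.
move=> cf; rewrite fineK//; apply: integrable_fin_num => //.
exact: segint_integrable.
Qed.

Lemma segint_ooE l r f : continuous f ->
  (\int[mu]_(x in `]l, r[) (f x)%:E)%E = (segint l r f)%:E.
Proof.
move=> cf; rewrite -segintE// [RHS]integral_itv_bndoo//.
by apply/measurable_EFinP; apply: measurable_funTS; exact: continuous_measurable_fun.
Qed.

Lemma segintD l r f g : continuous f -> continuous g ->
  segint l r (fun x => f x + g x) = segint l r f + segint l r g.
Proof. by move=> cf cg; apply: RintegralD => //; exact: segint_integrable. Qed.

Lemma segintB l r f g : continuous f -> continuous g ->
  segint l r (fun x => f x - g x) = segint l r f - segint l r g.
Proof. by move=> cf cg; apply: RintegralB => //; exact: segint_integrable. Qed.

Lemma segintZ l r k f : continuous f ->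
  segint l r (fun x => k * f x) = k * segint l r f.
Proof. by move=> cf; apply: RintegralZl => //; exact: segint_integrable. Qed.

Lemma segintZr l r k f : continuous f ->
  segint l r (fun x => f x * k) = segint l r f * k.
Proof. by move=> cf; apply: RintegralZr => //; exact: segint_integrable. Qed.

Lemma segint_ge0 l r f : (forall x, 0 <= f x) -> 0 <= segint l r f.
Proof. by move=> f0; apply: Rintegral_ge0. Qed.

Lemma segint_le l r f g : continuous f -> continuous g ->
  (forall x, l <= x <= r -> f x <= g x) -> segint l r f <= segint l r g.
Proof.
move=> cf cg fg; by apply: le_Rintegral => //; exact: segint_integrable.
Qed.

Lemma eq_segint l r f g : f =1 g -> segint l r f = segint l r g.
Proof. by move=> /funext ->. Qed.

Lemma segint_primitive l r f : continuous f ->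
  exists F : R -> R, (forall x, l <= x <= r -> is_derive x 1 F (f x)) /\
    forall x y, l <= x -> x <= y -> y <= r -> segint x y f = F y - F x.
Proof.
move=> cf; pose F x := segint (l - 1) x f.
have dF x : l <= x <= r -> is_derive x 1 F (f x).
  move=> /andP[lx xr].
  have [|||dF <-] := @continuous_FTC1_closed R f (l - 1) x (r + 1) _ _ _ (cf x).
  - lra.
  - exact: segint_integrable.
  - lra.
  - by rewrite derive1E; exact: derivableP.
exists F; split=> // x y lx xy yr.
have -> : segint x y f = (\int[mu]_(t in `]x, y]) f t)%R.
  rewrite /segint Rintegral_itv_obnd_cbnd//.
  apply: integrableS (segint_integrable x y cf) => //.
  exact: subset_itv_oc_cc.
rewrite -(@Rintegral_itvB _ _ (BLeft (l - 1)) (BRight y) x)//.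
- exact: segint_integrable.
- by rewrite bnd_simp; lra.
Qed.

Lemma segint_FTC l r f (F : R -> R) : l <= r -> continuous f ->
  (forall x : R, is_derive x 1 F (f x)) -> segint l r f = F r - F l.
Proof.
move=> lr cf dF; have [G [dG ->//]] := segint_primitive l r cf.
apply/eqP; rewrite -subr_eq0.
have -> : G r - G l - (F r - F l) = (G r - F r) - (G l - F l) by ring.
move: lr; rewrite le_eqVlt => /predU1P[->|lr]; first by rewrite subrr.
have [||z _ ->] := @MVT R (fun x => G x - F x) (fun=> 0) l r lr.
- move=> x /[!in_itv]/= /andP[lx xr].
  derive_by (first [exact: dF|apply: dG; rewrite !ltW//]).
  by rewrite subrr.
- apply/continuous_in_subspaceT => x /[!inE]/= /[!in_itv]/= xlr.
  by apply: continuousB; [apply: der_cont; exact: dG|apply: der_cont; exact: dF].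
- by rewrite mul0r.
Qed.

(** Differentiability is required in the interior only: [G] will have a
   singular expression at the midpoint of an interval. *)
Lemma segint_ge_der l r (p G dG : R -> R) : l <= r -> continuous p ->
  {within `[l, r], continuous G} ->
  (forall x : R, x \in `]l, r[ -> is_derive x 1 G (dG x)) ->
  (forall x : R, x \in `]l, r[ -> dG x <= p x) -> G r - G l <= segint l r p.
Proof.
move=> lr cp cG dGd le; have [F [dF ->//]] := segint_primitive l r cp.
suff : F l - G l <= F r - G r by lra.
apply: (@ler_der _ (fun x => F x - G x) (fun x => p x - dG x) l r lr).
- move=> x; apply: continuousB; last exact: cG.
  move: x; apply/continuous_in_subspaceT => x /[!inE]/= /[!in_itv]/= xlr.
  by apply: der_cont; exact: dF.
- move=> x xlr; have := dGd _ xlr; move: xlr; rewrite in_itv/= => /andP[lx xr] gx.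
  by derive_by (first [exact: gx|apply: dF; rewrite !ltW//]).
- by move=> x xlr; rewrite subr_ge0 le.
Qed.

Lemma segint_split l m r f : continuous f -> l <= m -> m <= r ->
  segint l r f = segint l m f + segint m r f.
Proof.
move=> cf lm mr; have [F [_ h]] := segint_primitive l r cf.
by rewrite !h// ?(le_trans lm)//; ring.
Qed.

Lemma segint_gt0 l r f : l < r -> continuous f -> (forall x, 0 <= f x) ->
  (forall x, l < x < r -> 0 < f x) -> 0 < segint l r f.
Proof.
move=> lr cf f0 fp; have [F [dF ->//]] := segint_primitive l r cf; last exact: ltW.
have [||z] := @MVT R F f l r lr.
- by move=> x /[!in_itv]/= /andP[lx xr]; apply: dF; rewrite !ltW.
- apply/continuous_in_subspaceT => x /[!inE]/= /[!in_itv]/= xlr.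
  by apply: der_cont; exact: dF.
- by rewrite in_itv/= => zlr ->; rewrite mulr_gt0 ?fp// subr_gt0.
Qed.

End SegmentIntegral.

Section PlaneIntegral.
Variable R : realType.
Local Notation mu := (@lebesgue_measure R).
Local Notation leb2 := (@lebesgue2 R).
Local Notation RR := (measurableTypeR R * measurableTypeR R)%type.
Implicit Types (F : plane R -> R) (l r b t : R).

(** An open set is the union of the open squares with rational centre and size that
   it contains. *)
Lemma plane_open_measurable (U : set RR) : open (U : set (plane R)) -> measurable U.
Proof.
move=> oU.
pose bx (q1 q2 q3 : rat) : set RR :=
  `](ratr q1 - ratr q3), (ratr q1 + ratr q3)[%classic `*`
  `](ratr q2 - ratr q3), (ratr q2 + ratr q3)[%classic.
have -> : U = \bigcup_(q1 : rat) \bigcup_(q2 : rat) \bigcup_(q3 : rat)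
    (if `[< bx q1 q2 q3 `<=` U >] then bx q1 q2 q3 else set0).
  apply/seteqP; split=> [[x y] Uxy|p [q1 _ [q2 _ [q3 _]]]]; last first.
    by case: asboolP => // h /h.
  have /nbhs_ballP[e /= e0 he] : nbhs ((x, y) : plane R) U by exact: open_nbhs_nbhs.
  have e2 : 0 < e / 2 by rewrite divr_gt0.
  have [q3 /[!in_itv]/= /andP[q30 q3e]] := rat_in_itvoo e2.
  have [q1 /[!in_itv]/= /andP[q1x q1y]] : exists q, ratr q \in `](x - ratr q3), (x + ratr q3)[.
    by apply: rat_in_itvoo; lra.
  have [q2 /[!in_itv]/= /andP[q2x q2y]] : exists q, ratr q \in `](y - ratr q3), (y + ratr q3)[.
    by apply: rat_in_itvoo; lra.
  exists q1 => //; exists q2 => //; exists q3 => //; rewrite asboolT.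
    by split; rewrite /= in_itv/=; apply/andP; split; lra.
  move=> [u v] [/= /[!in_itv]/= /andP[u1 u2] /andP[v1 v2]].
  apply: he; split => /=; rewrite /ball/= ltr_norml; apply/andP; split; lra.
apply: bigcupT_measurable_rat => q1; apply: bigcupT_measurable_rat => q2.
apply: bigcupT_measurable_rat => q3; case: asboolP => // _.
by apply: measurableX; exact: measurable_itv.
Qed.

Lemma plane_continuous_measurable F : continuous F ->
  measurable_fun [set: RR] (F : RR -> R).
Proof.
move=> cF mD; apply: (measurability _ (RGenOInfty.measurableE R)) => //.
move=> /= _ [_ [x ->] <-]; rewrite setTI.
apply: plane_open_measurable; apply: open_comp; last exact: interval_open.
by move=> p _; exact: cF.
Qed.

Definition box l r b t : set (plane R) :=
  (`]l, r[%classic `*` `]b, t[%classic).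

Lemma box_measurable l r b t : measurable (box l r b t : set RR).
Proof. by apply: measurableX; exact: measurable_itv. Qed.

Lemma box_finite l r b t : (leb2 (box l r b t) < +oo)%E.
Proof.
have -> : leb2 (box l r b t) = (mu `]l, r[%classic * mu `]b, t[%classic)%E.
  by apply: product_measure1E; exact: measurable_itv.
rewrite !lebesgue_measure_itv/=; do 2 case: ifPn => _ //;
  by rewrite ?mul0e ?mule0 ?ltry// -!EFinB -EFinM ltry.
Qed.

Lemma continuous_bounded_on_box l r b t F : continuous F ->
  exists M, forall p, box l r b t p -> `|F p| <= M.
Proof.
move=> cF; have : compact (F @` (`[l, r]%classic `*` `[b, t]%classic)).
  apply: continuous_compact; first exact: continuous_subspaceT.
  by apply: compact_setX; exact: segment_compact.
move=> /compact_bounded[M [_ hM]]; exists (M + 1) => -[x y] [/= xl yb].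
apply: hM; first by rewrite ltrDl.
by exists (x, y) => //; split; apply: subset_itv_oo_cc.
Qed.

Lemma box_integrable l r b t F : continuous F ->
  leb2.-integrable (box l r b t) (EFin \o F).
Proof.
move=> cF; apply: measurable_bounded_integrable.
- exact: box_measurable.
- exact: box_finite.
- by apply: measurable_funTS; exact: plane_continuous_measurable.
- have [M hM] := continuous_bounded_on_box l r b t cF.
  exists M; split; first exact: num_real.
  by move=> N MN p /hM h; exact: (le_trans h (ltW MN)).
Qed.

Lemma slice1_continuous F y : continuous F -> continuous (fun x => F (x, y)).
Proof. by move=> cF; cts. Qed.

Lemma slice2_continuous F x : continuous F -> continuous (fun y => F (x, y)).
Proof. by move=> cF; cts. Qed.

Lemma swap_continuous F : continuous F -> continuous (fun p => F (p.2, p.1)).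
Proof. by move=> cF; cts. Qed.

Lemma segint_param_continuous F b t : continuous F ->
  continuous (fun x => segint b t (fun y => F (x, y))).
Proof.
move=> cF x.
have : {in `](x - 1), (x + 1)[%classic,
    continuous (fun x => segint b t (fun y => F (x, y)))}.
  have /compact_bounded[M [_ hM]] :
      compact (F @` (`[x - 1, x + 1]%classic `*` `[b, t]%classic)).
    apply: continuous_compact; first exact: continuous_subspaceT.
    by apply: compact_setX; exact: segment_compact.
  apply: (@continuity_under_integral R _ _ mu (fun x y => F (x, y)) `[b, t] _ _ _ _ _
    (fun=> M + 1)) => //.
  - by move=> u _; apply: segint_integrable; exact: slice2_continuous.
  - by apply/aeW => y _ u _; exact: slice1_continuous.
  - by apply: segint_integrable; cts.
  - move=> u xu; apply/aeW => y yb; apply: hM; first by rewrite ltrDl.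
    by exists (u, y) => //; split => //=; exact: subset_itv_oo_cc.
by apply; rewrite inE/= in_itv/=; apply/andP; split; lra.
Qed.

Lemma box_integrable_mkcond l r b t F : continuous F ->
  leb2.-integrable [set: RR] ((EFin \o F) \_ (box l r b t)).
Proof.
move=> cF.
apply (@integrable_mkcond _ _ _ leb2 _ (EFin \o F) (box_measurable l r b t)).
exact: box_integrable.
Qed.

Lemma box_integral12 l r b t F : continuous F ->
  (\int[leb2]_(p in box l r b t) (F p)%:E)%E =
  (segint l r (fun x => segint b t (fun y => F (x, y))))%:E.
Proof.
move=> cF; rewrite integral_mkcond -integral12_prod_meas1; last exact: box_integrable_mkcond.
rewrite -segint_ooE; last exact: segint_param_continuous.
rewrite [RHS]integral_mkcond; apply: eq_integral => x _.
rewrite /fubini_F patchE; case: ifPn => xl.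
  rewrite -segint_ooE; last exact: slice2_continuous.
  rewrite [RHS]integral_mkcond; apply: eq_integral => y _.
  by rewrite !patchE /box in_setX/= xl.
rewrite integral0_eq// => y _.
by rewrite patchE /box in_setX/= (negbTE xl).
Qed.

Lemma box_integral21 l r b t F : continuous F ->
  (\int[leb2]_(p in box l r b t) (F p)%:E)%E =
  (segint b t (fun y => segint l r (fun x => F (x, y))))%:E.
Proof.
move=> cF; rewrite integral_mkcond -integral21_prod_meas1; last exact: box_integrable_mkcond.
rewrite -segint_ooE; last first.
  exact: (@segint_param_continuous (fun p => F (p.2, p.1)) _ _ (swap_continuous cF)).
rewrite [RHS]integral_mkcond; apply: eq_integral => y _.
rewrite /fubini_G patchE; case: ifPn => yl.
  rewrite -segint_ooE; last exact: slice1_continuous.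
  rewrite [RHS]integral_mkcond; apply: eq_integral => x _.
  by rewrite !patchE /box in_setX/= yl andbT.
rewrite integral0_eq// => x _.
by rewrite patchE /box in_setX/= (negbTE yl) andbF.
Qed.

End PlaneIntegral.

(** * The Robin form of an interval *)

Section IntervalModes.
Variable R : realType.
Implicit Types (alpha l r mu nu : R) (X dX Y dY f df : R -> R).

(** The first two modes of an interval in general position; what remains of parity
   is that the critical point of [X] and the zero of [Y] are the midpoint. *)
Record interval_modes alpha l r mu nu X dX Y dY : Prop := IntervalModes {
  im_hzX : helmholtz mu X dX;
  im_hzY : helmholtz nu Y dY;
  im_gap : mu < nu;
  im_X_gt0 : forall x : R, l <= x <= r -> 0 < X x;
  im_Y_neq0 : forall x : R, l <= x <= r -> x != (l + r) / 2 -> Y x != 0;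
  im_dX0 : dX ((l + r) / 2) = 0;
  im_Y0 : Y ((l + r) / 2) = 0;
  im_dY0 : dY ((l + r) / 2) != 0;
  im_Xr : dX r = - alpha * X r;
  im_Xl : dX l = alpha * X l;
  im_Yr : dY r = - alpha * Y r;
  im_Yl : dY l = alpha * Y l }.

Lemma interval_modes_translate alpha l r mu nu X dX Y dY : l < r ->
  even_mode alpha ((r - l) / 2) mu X dX -> odd_mode alpha ((r - l) / 2) nu Y dY ->
  let m := (l + r) / 2 in
  interval_modes alpha l r mu nu (fun x => X (x - m)) (fun x => dX (x - m))
    (fun x => Y (x - m)) (fun x => dY (x - m)).
Proof.
move=> lr eX oY m; pose c := (r - l) / 2.
have c0 : 0 < c by rewrite /c; lra.
have [gap _] := mode_wronskian_gt0 c0 eX oY.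
have rm : r - m = c by rewrite /c /m; lra.
have lm : l - m = - c by rewrite /c /m; lra.
have mm : m - m = 0 by rewrite subrr.
have trans_hz k Z dZ : helmholtz k Z dZ ->
    helmholtz k (fun x => Z (x - m)) (fun x => dZ (x - m)).
  move=> [dd ddd]; split=> x.
    by derive_by (first [exact: dd|exact: ddd]); rewrite -?mulrA subr0 mulr1.
  by derive_by (first [exact: dd|exact: ddd]); rewrite -?mulrA subr0 mulr1.
have dX0 := even_mode_dX0 eX; have Y0 := odd_mode_X0 oY.
case: eX oY => hX eX edX Xp rX [hY oY odY Yp sl rY]; split=> //=.
- exact: trans_hz.
- exact: trans_hz.
- move=> x /andP[lx xr]; have [xm|xm] := leP 0 (x - m).
    by apply: Xp; rewrite xm/=; rewrite /m; lra.
  by rewrite -eX; apply: Xp; rewrite oppr_ge0 ltW//= /m; lra.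
- move=> x /andP[lx xr]; have [xm _|xm _|//] := ltgtP x m.
    rewrite -oppr_eq0 -oY gt_eqF// Yp//; rewrite /m in xm *; lra.
  by rewrite gt_eqF// Yp//; rewrite /m in xm *; lra.
- by rewrite mm.
- by rewrite mm.
- by rewrite mm gt_eqF.
- by rewrite rm.
- by rewrite lm edX rX eX mulNr opprK.
- by rewrite rm.
- by rewrite lm odY rY oY mulNr mulrN.
Qed.

Lemma is_derive_cvg (V W : normedModType R) (f : V -> W) (x v : V) (d : W) :
  is_derive x v f d <-> h^-1 *: (f (h *: v + x) - f x) @[h --> 0^'] --> d.
Proof.
split=> [[dm <-] //|fd].
by apply: DeriveDef; [apply/cvg_ex; exists d|exact: cvg_lim].
Qed.

(** Near [m], the quotient is [(a / (x - m)) ^ 2 (x - m) / (b / (x - m))]; its value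
   at [m] is [0] by the convention on division. *)
Lemma sqr_div_continuous (a b : R -> R) (m da db : R) :
  is_derive m 1 a da -> is_derive m 1 b db -> a m = 0 -> b m = 0 -> db != 0 ->
  {for m, continuous (fun x => a x ^+ 2 / b x)}.
Proof.
have quot (g : R -> R) dg : is_derive m 1 g dg -> g m = 0 ->
    h^-1 * g (h + m) @[h --> 0^'] --> dg.
  move=> /is_derive_cvg gd gm.
  suff -> : (fun h => h^-1 * g (h + m)) = (fun h => h^-1 *: (g (h *: 1 + m) - g m)).
    exact: gd.
  by apply/funext => h; rewrite gm subr0 [h%:A]mulr1.
move=> ad bd am bm db0; rewrite continuous_shift.
have -> : (fun x => a x ^+ 2 / b x) \o shift m =
    (fun h => (h^-1 * a (h + m)) * (h^-1 * a (h + m)) * (h * (h^-1 * b (h + m))^-1)).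
  apply/funext => h /=; have [->|h0] := eqVneq h 0.
    by rewrite add0r am bm expr0n !(mul0r, mulr0).
  rewrite invfM invrK expr2.
  by move: (b _)^-1 => bi; field.
apply/continuous_withinNx.
have -> : 0^-1 * a (0 + m) * (0^-1 * a (0 + m)) * (0 * (0^-1 * b (0 + m))^-1) =
  da * da * (0 * db^-1) by rewrite !mul0r !mulr0.
apply: cvgM; first by apply: cvgM; exact: quot.
apply: cvgM; first exact: cvg_within.
by apply: cvgV => //; exact: quot.
Qed.

Section Inequalities.
Variables (alpha l r mu nu : R) (X dX Y dY : R -> R).
Hypothesis lr : l < r.
Hypothesis im : interval_modes alpha l r mu nu X dX Y dY.
Let m := (l + r) / 2.

Let lm : l < m. Proof. by rewrite /m; move: lr => ?; lra. Qed.
Let mr : m < r. Proof. by rewrite /m; move: lr => ?; lra. Qed.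

Lemma helmholtz_continuous (k : R) (Z dZ : R -> R) : helmholtz k Z dZ ->
  continuous Z /\ continuous dZ.
Proof. by move=> [d1 d2]; split=> x; exact: der_cont. Qed.

Lemma im_cX : continuous X. Proof. by have [] := helmholtz_continuous (im_hzX im). Qed.
Lemma im_cdX : continuous dX. Proof. by have [] := helmholtz_continuous (im_hzX im). Qed.
Lemma im_cY : continuous Y. Proof. by have [] := helmholtz_continuous (im_hzY im). Qed.
Lemma im_cdY : continuous dY. Proof. by have [] := helmholtz_continuous (im_hzY im). Qed.

Lemma im_normX_gt0 : 0 < segint l r (fun x => X x ^+ 2).
Proof.
have cX := im_cX.
apply: segint_gt0 => //; [by cts|by move=> x; exact: sqr_ge0|].
by move=> x /andP[lx xr]; rewrite exprn_gt0// (im_X_gt0 im)// !ltW.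
Qed.

Lemma im_normY_gt0 : 0 < segint l r (fun x => Y x ^+ 2).
Proof.
have cY := im_cY.
have cY2 : continuous (fun x => Y x ^+ 2) by cts.
rewrite (@segint_split _ l m r)//; [|exact: ltW..].
apply: addr_gt0; apply: segint_gt0 => //; try by move=> x; exact: sqr_ge0.
- move=> x /andP[lx xr]; rewrite exprn_even_gt0//= (im_Y_neq0 im)//.
    by rewrite (ltW lx)/= ltW// (lt_trans xr).
  by rewrite lt_eqF.
- move=> x /andP[lx xr]; rewrite exprn_even_gt0//= (im_Y_neq0 im)//.
    by rewrite (ltW xr) andbT ltW// (lt_trans lm).
  by rewrite gt_eqF.
Qed.

Lemma norm_subr_mode f (k : R) : continuous f ->
  segint l r (fun x => (f x - k * X x) ^+ 2) =
  segint l r (fun x => f x ^+ 2) - 2 * k * segint l r (fun x => f x * X x)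
    + k ^+ 2 * segint l r (fun x => X x ^+ 2).
Proof.
move=> cf; have cX := im_cX.
have -> : segint l r (fun x => (f x - k * X x) ^+ 2) =
    segint l r (fun x => f x ^+ 2 - 2 * k * (f x * X x) + k ^+ 2 * X x ^+ 2).
  by apply: eq_segint => x; ring.
by rewrite segintD ?segintB ?segintZ; [|cts..].
Qed.

Lemma norm_subr_projection f : continuous f ->
  let N := segint l r (fun x => X x ^+ 2) in
  let w := segint l r (fun x => f x * X x) in
  segint l r (fun x => (f x - w / N * X x) ^+ 2) =
  segint l r (fun x => f x ^+ 2) - w ^+ 2 / N.
Proof.
move=> cf N w; rewrite norm_subr_mode// -/N -/w.
by field; rewrite gt_eqF// im_normX_gt0.
Qed.

Lemma cauchy_schwarz_mode f : continuous f ->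
  segint l r (fun x => f x * X x) ^+ 2 / segint l r (fun x => X x ^+ 2) <=
  segint l r (fun x => f x ^+ 2).
Proof.
move=> cf; rewrite -subr_ge0 -norm_subr_projection//.
by apply: segint_ge0 => x; exact: sqr_ge0.
Qed.

Section Lower.
Variables f df : R -> R.
Hypothesis fd : forall x : R, is_derive x 1 f (df x).
Hypothesis cdf : continuous df.

Let cf : continuous f. Proof. by move=> x; exact: der_cont (fd x). Qed.
Let t := f m / X m.
Let h x := f x - t * X x.
Let dh x := df x - t * dX x.
Let G x := h x ^+ 2 / Y x * dY x + (2 * t * h x * dX x + t ^+ 2 * X x * dX x).
Let p x := df x ^+ 2 - mu * f x ^+ 2 - (nu - mu) * h x ^+ 2.

Let hd (x : R) : is_derive x 1 h (dh x).
Proof.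
rewrite /h; derive_by (first [exact: fd|exact: (hz_d (im_hzX im))]).
by rewrite /dh; ring.
Qed.

Let hm : h m = 0.
Proof. by rewrite /h /t divfK ?subrr// gt_eqF// (im_X_gt0 im)// !ltW. Qed.

Let Gd (x : R) : l <= x <= r -> x != m ->
  is_derive x 1 G (p x - (dh x - dY x / Y x * h x) ^+ 2).
Proof.
move=> xlr xm; have Y0 := im_Y_neq0 im xlr xm; rewrite /G.
derive_by (first [exact: hd|exact: (hz_d (im_hzX im))|exact: (hz_dd (im_hzX im))
  |exact: (hz_d (im_hzY im))|exact: (hz_dd (im_hzY im))|exact: Y0]).
have -> : p x = (dh x + t * dX x) ^+ 2 - mu * (h x + t * X x) ^+ 2
    - (nu - mu) * h x ^+ 2 by rewrite /p /dh /h !subrK.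
have : Y x / Y x = 1 by rewrite divff.
rewrite -exprVn; move: (h x) (dh x) (X x) (dX x) (Y x) (dY x) (Y x)^-1 t.
clear=> h dh X dX Y dY i t Yi; apply/eqP; rewrite -subr_eq0; apply/eqP.
by transitivity (- nu * h ^+ 2 * (Y * i - 1)); [ring|rewrite Yi subrr mulr0].
Qed.

Let Gc (A : set R) : A `<=` `[l, r]%classic -> {within A, continuous G}.
Proof.
move=> Alr; apply/continuous_in_subspaceT => x /[!inE]/Alr/= /[!in_itv]/= xlr.
have [cX cdX cdY ch] : [/\ continuous X, continuous dX, continuous dY & continuous h].
  by split; [exact: im_cX|exact: im_cdX|exact: im_cdY|move=> y; exact: der_cont (hd y)].
have cB : continuous (fun x => 2 * t * h x * dX x + t ^+ 2 * X x * dX x) by cts.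
have [xm|/eqP xm] := pselect (x = m); last exact: der_cont (Gd xlr xm).
have ck := sqr_div_continuous (hd m) (hz_d (im_hzY im) m) hm (im_Y0 im) (im_dY0 im).
rewrite xm; exact: (continuousD (continuousM ck (cdY m)) (cB m)).
Qed.

(** [p - G'] is a square on each half of the interval, [G] vanishes at the midpoint,
   and its values at the ends are the boundary terms of the form. *)
Lemma robin_gap_pointwise :
  (nu - mu) * segint l r (fun x => (f x - t * X x) ^+ 2) <=
  segint l r (fun x => df x ^+ 2) + alpha * (f l ^+ 2 + f r ^+ 2)
    - mu * segint l r (fun x => f x ^+ 2).
Proof.
have cX := im_cX.
have ch : continuous h by rewrite /h; cts.
have cp : continuous p by rewrite /p; cts.
have -> : segint l r (fun x => df x ^+ 2) + alpha * (f l ^+ 2 + f r ^+ 2)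
    - mu * segint l r (fun x => f x ^+ 2) =
    segint l r p + alpha * (f l ^+ 2 + f r ^+ 2)
    + (nu - mu) * segint l r (fun x => h x ^+ 2).
  by rewrite /p !segintB ?segintZ; [ring|cts..].
rewrite lerDr; have : G m = 0 by rewrite /G hm (im_dX0 im); ring.
have : G r = - alpha * f r ^+ 2.
  have ? : Y r != 0 by apply: (im_Y_neq0 im); [rewrite ltW//=|rewrite gt_eqF].
  by rewrite /G (im_Xr im) (im_Yr im) /h; field.
have : G l = alpha * f l ^+ 2.
  have ? : Y l != 0 by apply: (im_Y_neq0 im); [rewrite lexx ltW//=|rewrite lt_eqF].
  by rewrite /G (im_Xl im) (im_Yl im) /h; field.
have half u v : l <= u -> u < v -> v <= r -> (v <= m) || (m <= u) -> G v - G u <= segint u v p.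
  move=> lu uv vr uvm; apply: (segint_ge_der (ltW uv) cp
    (dG := fun x => p x - (dh x - dY x / Y x * h x) ^+ 2)).
  - by apply: Gc => x /=; rewrite !in_itv/= => /andP[ux xv];
      rewrite (le_trans lu)//= (le_trans xv).
  - move=> x; rewrite in_itv/= => /andP[ux xv]; apply: Gd.
      by rewrite (le_trans lu (ltW ux))/= (le_trans (ltW xv)).
    by case/orP: uvm => [vm|mu']; [rewrite lt_eqF// (lt_le_trans xv)|rewrite gt_eqF// (le_lt_trans mu')].
  - by move=> x _; rewrite gerBl sqr_ge0.
have := half _ _ (ltW lm) mr (lexx r); rewrite lexx orbT => /(_ isT).
have := half _ _ (lexx l) lm (ltW mr); rewrite lexx => /(_ isT).
rewrite (@segint_split _ l m r)//; [|exact: ltW..].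
set a := segint _ _ _; set b := segint _ _ _; lra.
Qed.

Let N := segint l r (fun x => X x ^+ 2).
Let n := segint l r (fun x => f x ^+ 2).
Let w := segint l r (fun x => f x * X x).

(** Among the functions [f - k X], the orthogonal projection of [f] has the smallest
   norm; in particular it is no larger than the function vanishing at the
   midpoint. *)
Lemma robin_gap_inequality :
  (nu - mu) * (n - w ^+ 2 / N) <=
  segint l r (fun x => df x ^+ 2) + alpha * (f l ^+ 2 + f r ^+ 2) - mu * n.
Proof.
have N0 : 0 < N by exact: im_normX_gt0.
apply: le_trans robin_gap_pointwise; rewrite ler_pM2l ?subr_gt0 ?(im_gap im)//.
rewrite norm_subr_mode// -subr_ge0 -/N -/n -/w.
have -> : n - 2 * t * w + t ^+ 2 * N - (n - w ^+ 2 / N) = N * (t - w / N) ^+ 2.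
  by field; rewrite gt_eqF.
by rewrite mulr_ge0 ?sqr_ge0// ltW.
Qed.

End Lower.

Section Upper.
Variables c1 c2 : R.
Let f x := c1 * X x + c2 * Y x.
Let df x := c1 * dX x + c2 * dY x.

(** The Wronskian of two functions with the same Robin condition vanishes at the
   ends. *)
Lemma modes_orthogonal : segint l r (fun x => X x * Y x) = 0.
Proof.
have cX := im_cX; have cY := im_cY.
have cp : continuous (fun x => (mu - nu) * (X x * Y x)) by cts.
have := segint_FTC (ltW lr) cp (helmholtz_wronskian (im_hzX im) (im_hzY im)).
rewrite segintZ; [|by cts]; rewrite (im_Xr im) (im_Yr im) (im_Xl im) (im_Yl im).
have -> : - alpha * Y r * X r - Y r * (- alpha * X r) -
  (alpha * Y l * X l - Y l * (alpha * X l)) = 0 by ring.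
by move/eqP; rewrite mulf_eq0 subr_eq0 lt_eqF ?(im_gap im)//= => /eqP.
Qed.

Lemma combination_norm : segint l r (fun x => f x ^+ 2) =
  c1 ^+ 2 * segint l r (fun x => X x ^+ 2) + c2 ^+ 2 * segint l r (fun x => Y x ^+ 2).
Proof.
have cX := im_cX; have cY := im_cY.
have -> : segint l r (fun x => f x ^+ 2) = segint l r (fun x =>
    c1 ^+ 2 * X x ^+ 2 + c2 ^+ 2 * Y x ^+ 2 + 2 * c1 * c2 * (X x * Y x)).
  by apply: eq_segint => x; rewrite /f; ring.
rewrite segintD ?segintD ?segintZ; [|cts..].
by rewrite modes_orthogonal mulr0 addr0.
Qed.

Lemma combination_form :
  segint l r (fun x => df x ^+ 2) + alpha * (f l ^+ 2 + f r ^+ 2) =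
  mu * (c1 ^+ 2 * segint l r (fun x => X x ^+ 2)) +
  nu * (c2 ^+ 2 * segint l r (fun x => Y x ^+ 2)).
Proof.
have cX := im_cX; have cY := im_cY; have cdX := im_cdX; have cdY := im_cdY.
have fd (x : R) : is_derive x 1 f (df x).
  rewrite /f; derive_by (first [exact: (hz_d (im_hzX im))|exact: (hz_d (im_hzY im))]).
  by rewrite /df; ring.
have dfd (x : R) : is_derive x 1 df (- c1 * mu * X x - c2 * nu * Y x).
  rewrite /df; derive_by (first [exact: (hz_dd (im_hzX im))|exact: (hz_dd (im_hzY im))]).
  by ring.
pose q x := df x ^+ 2 - mu * c1 ^+ 2 * X x ^+ 2 - nu * c2 ^+ 2 * Y x ^+ 2
  - (mu + nu) * c1 * c2 * (X x * Y x).
have qE : segint l r q = f r * df r - f l * df l.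
  apply: (@segint_FTC _ l r q (fun x => f x * df x)); [exact: ltW|by rewrite /q /df; cts|].
  move=> x; derive_by (first [exact: fd|exact: dfd]).
  by rewrite /q /df /f; ring.
have : segint l r q = segint l r (fun x => df x ^+ 2) -
    mu * c1 ^+ 2 * segint l r (fun x => X x ^+ 2) -
    nu * c2 ^+ 2 * segint l r (fun x => Y x ^+ 2).
  rewrite /q /df !segintB ?segintZ ?modes_orthogonal; [|cts..].
  by rewrite mulr0 subr0.
rewrite qE.
have -> : f r * df r = - alpha * f r ^+ 2.
  by rewrite /df /f (im_Xr im) (im_Yr im); ring.
have -> : f l * df l = alpha * f l ^+ 2.
  by rewrite /df /f (im_Xl im) (im_Yl im); ring.
move: (segint l r _) (segint l r _) (segint l r _) => A B C.
rewrite !mulrA; lra.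
Qed.

End Upper.
End Inequalities.
End IntervalModes.

(** * Invariance of the area under rotations *)

Section RotationInvariance.
Variable R : realType.
Local Notation mu := (@lebesgue_measure R).
Local Notation leb2 := (@lebesgue2 R).
Local Notation RR := (measurableTypeR R * measurableTypeR R)%type.
Implicit Types (F : plane R -> R) (k c s : R).

Lemma lebesgue_measure_translate k (A : set (measurableTypeR R)) : measurable A ->
  mu ((fun x : R => x + k) @^-1` A) = mu A.
Proof.
have mt : measurable_fun setT ((fun x : R => x + k) : measurableTypeR R -> measurableTypeR R).
  by apply: continuous_measurable_fun; cts.
move=> mA; apply/esym.
apply: (lebesgue_measure_unique (mu := pushforward mu
  ((fun x : R => x + k) : measurableTypeR R -> measurableTypeR R))) => //= _ [[a b]] _ <-.
rewrite /pushforward; have -> : (fun x : R => x + k) @^-1` `]a, b]%classic = `](a - k), (b - k)]%classic.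
  by apply/seteqP; split=> x /=; rewrite !in_itv/= ltrBlDr lerBrDr.
rewrite !lebesgue_measure_itv/= !lte_fin ltrD2r -!EFinB.
by have -> : b - k - (a - k) = b - a by ring.
Qed.

Definition area_preserving (f : plane R -> plane R) : Prop :=
  continuous f /\ forall A : set RR, measurable A -> leb2 (f @^-1` A) = leb2 A.

Lemma plane_map_measurable (f : plane R -> plane R) : continuous f ->
  measurable_fun [set: RR] (f : RR -> RR).
Proof.
move=> cf; apply/measurable_fun_pairP; split.
- by apply: (@plane_continuous_measurable R (fun p => (f p).1)); cts.
- by apply: (@plane_continuous_measurable R (fun p => (f p).2)); cts.
Qed.

Lemma area_preserving_comp f g : area_preserving f -> area_preserving g ->
  area_preserving (fun p => f (g p)).
Proof.
move=> [cf af] [cg ag]; split=> [|A mA]; first exact: cts_comp cg cf.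
rewrite -(af A mA) -(ag (f @^-1` A))//.
by rewrite -[_ @^-1` _]setTI; exact: plane_map_measurable.
Qed.

Lemma area_preserving_shear2 k : area_preserving (fun p => (p.1, p.2 + k * p.1)).
Proof.
split=> [|A mA]; first by cts.
rewrite /lebesgue2 /= /product_measure1; apply: eq_integral => x _ /=.
rewrite -(@lebesgue_measure_translate (k * x) (xsection A x)); last exact: measurable_xsection.
by congr (mu _); apply/seteqP; split=> y; rewrite /xsection /= !inE.
Qed.

(** The area is computed by slicing in the other direction, which is legitimate by
   uniqueness of the product measure. *)
Lemma area_preserving_shear1 k : area_preserving (fun p => (p.1 + k * p.2, p.2)).
Proof.
have cf : continuous (fun p : plane R => (p.1 + k * p.2, p.2)) by cts.
split=> [//|A mA].
have mu2E (B : set RR) : measurable B -> leb2 B = (mu \x^ mu)%E B.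
  move=> mB; apply: product_measure_unique => // C D mC mD.
  exact: product_measure2E.
rewrite !mu2E//; last first.
  by rewrite -[_ @^-1` _]setTI; exact: plane_map_measurable.
rewrite /= /product_measure2; apply: eq_integral => y _ /=.
rewrite -(@lebesgue_measure_translate (k * y) (ysection A y)); last exact: measurable_ysection.
by congr (mu _); apply/seteqP; split=> x; rewrite /ysection /= !inE.
Qed.

(** A rotation is a product of three shears, unless it is the half-turn, which
   is the square of the quarter-turn. *)
Lemma area_preserving_rotation c s : c ^+ 2 + s ^+ 2 = 1 ->
  area_preserving (fun p => (c * p.1 - s * p.2, s * p.1 + c * p.2)).
Proof.
have three c' s' : c' ^+ 2 + s' ^+ 2 = 1 -> c' != -1 ->
    area_preserving (fun p => (c' * p.1 - s' * p.2, s' * p.1 + c' * p.2)).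
  move=> cs c1; have c10 : 1 + c' != 0 by rewrite addrC -[1]opprK subr_eq0.
  have h := area_preserving_comp (area_preserving_shear1 (- (s' / (1 + c'))))
    (area_preserving_comp (area_preserving_shear2 s') (area_preserving_shear1 (- (s' / (1 + c'))))).
  suff <- : (fun p : plane R => ((p.1 + - (s' / (1 + c')) * p.2)
      + - (s' / (1 + c')) * (p.2 + s' * (p.1 + - (s' / (1 + c')) * p.2)),
      p.2 + s' * (p.1 + - (s' / (1 + c')) * p.2))) =
     (fun p => (c' * p.1 - s' * p.2, s' * p.1 + c' * p.2)) by exact: h.
  have s2 : s' * (s' / (1 + c')) = 1 - c'.
    have -> : s' * (s' / (1 + c')) = s' ^+ 2 / (1 + c') by ring.
    have -> : s' ^+ 2 = (1 - c') * (1 + c') by rewrite -[s' ^+ 2](addKr (c' ^+ 2)) cs; ring.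
    by rewrite mulfK.
  have t2 : s' / (1 + c') * (1 + c') = s' by rewrite divfK.
  apply/funext => -[x y] /=; move: (s' / (1 + c')) s2 t2 => t s2 t2.
  congr pair.
  - transitivity ((1 - s' * t) * x - t * (1 + (1 - s' * t)) * y); first by ring.
    by rewrite s2 !subKr t2.
  - transitivity (s' * x + (1 - s' * t) * y); first by ring.
    by rewrite s2 subKr.
move=> cs; have [c1|/three] := eqVneq c (-1); last exact.
have s0 : s = 0.
  by apply/eqP; rewrite -sqrf_eq0 -[s ^+ 2](addKr (c ^+ 2)) cs c1; apply/eqP; ring.
have q : area_preserving (fun p : plane R => (0 * p.1 - 1 * p.2, 1 * p.1 + 0 * p.2)).
  apply: three; first by ring.
  by rewrite eq_sym oppr_eq0 oner_eq0.
suff -> : (fun p : plane R => (c * p.1 - s * p.2, s * p.1 + c * p.2)) =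
    (fun p => (0 * (0 * p.1 - 1 * p.2) - 1 * (1 * p.1 + 0 * p.2),
      1 * (0 * p.1 - 1 * p.2) + 0 * (1 * p.1 + 0 * p.2))).
  exact: (area_preserving_comp q q).
by rewrite c1 s0; apply/funext => -[x y] /=; congr pair; ring.
Qed.

Lemma rotationK (theta : R) : cancel (rotation theta) (rotation (- theta)).
Proof.
move=> [x y]; have := cos2Dsin2 theta; rewrite /rotation /= cosN sinN.
by move: (cos theta) (sin theta) => c s cs; congr pair; rewrite -[RHS]mul1r -cs; ring.
Qed.

Lemma rotationNK (theta : R) : cancel (rotation (- theta)) (rotation theta).
Proof. by have := rotationK (- theta); rewrite opprK. Qed.

Lemma rotation_continuous (theta : R) : continuous (rotation theta).
Proof. by rewrite /rotation; cts. Qed.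

Lemma rotation_image (theta : R) (B : set (plane R)) :
  rotation theta @` B = rotation (- theta) @^-1` B.
Proof.
apply/seteqP; split=> [_ [p Bp <-]|p Bp] /=; first by rewrite rotationK.
by exists (rotation (- theta) p) => //; rewrite rotationNK.
Qed.

Lemma rect_setE (Q : rectangle R) : rect_set Q =
  rotation (- rangle Q) @^-1` box (rleft Q) (rright Q) (rbottom Q) (rtop Q).
Proof. exact: rotation_image. Qed.

Lemma rect_measurable (Q : rectangle R) : measurable (rect_set Q : set RR).
Proof.
rewrite rect_setE -[_ @^-1` _]setTI.
by apply: (plane_map_measurable (@rotation_continuous _)) => //; exact: box_measurable.
Qed.

Lemma rotation_rect (Q : rectangle R) : rotation (rangle Q) @^-1` rect_set Q =
  box (rleft Q) (rright Q) (rbottom Q) (rtop Q).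
Proof. by rewrite rect_setE; apply/seteqP; split=> p /=; rewrite rotationK. Qed.

Lemma rotation_preserves (theta : R) (A : set RR) : measurable A ->
  leb2 (rotation theta @^-1` A) = leb2 A.
Proof. by apply: (area_preserving_rotation (cos2Dsin2 theta)).2. Qed.

Lemma rect_finite (Q : rectangle R) : (leb2 (rect_set Q) < +oo)%E.
Proof.
rewrite -(rotation_preserves (rangle Q) (rect_measurable Q)) rotation_rect.
exact: box_finite.
Qed.

Lemma rect_change_of_variables (Q : rectangle R) F : continuous F ->
  (\int[leb2]_(p in rect_set Q) (F p)%:E =
   \int[leb2]_(p in box (rleft Q) (rright Q) (rbottom Q) (rtop Q))
     (F (rotation (rangle Q) p))%:E)%E.
Proof.
move=> cF; have mr := plane_map_measurable (@rotation_continuous (rangle Q)).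
transitivity (\int[pushforward leb2 (rotation (rangle Q) : RR -> RR)]_(p in rect_set Q) (F p)%:E)%E.
  apply: eq_measure_integral => A mA _.
  by apply/esym; exact: rotation_preserves.
rewrite (@integral_pushforward _ _ _ _ _ _ mr).
- by rewrite rotation_rect.
- by apply/measurable_EFinP; exact: plane_continuous_measurable.
- rewrite rotation_rect; apply: (@box_integrable R _ _ _ _ (fun p => F (rotation (rangle Q) p))).
  exact: cts_comp (@rotation_continuous _) cF.
- exact: rect_measurable.
Qed.

Lemma continuous_bounded_on_rect (Q : rectangle R) F : continuous F ->
  exists M, forall p, rect_set Q p -> `|F p| <= M.
Proof.
move=> cF; have cG := cts_comp (@rotation_continuous (rangle Q)) cF.
have [M hM] := continuous_bounded_on_box (rleft Q) (rright Q) (rbottom Q) (rtop Q) cG.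
by exists M => _ [p bp <-]; exact: hM.
Qed.

Lemma rect_integrable (Q : rectangle R) F : continuous F ->
  leb2.-integrable (rect_set Q) (EFin \o F).
Proof.
move=> cF; apply: measurable_bounded_integrable.
- exact: rect_measurable.
- exact: rect_finite.
- by apply: measurable_funTS; exact: plane_continuous_measurable.
- have [M hM] := continuous_bounded_on_rect Q cF.
  exists M; split; first exact: num_real.
  by move=> N MN p /hM h; exact: (le_trans h (ltW MN)).
Qed.

End RotationInvariance.

(** * Chain rule for functions of class [C^1] *)

Section ChainRule.
Variable R : realType.
Implicit Types (phi : plane R -> R).

Lemma MVT_between (f df : R -> R) (a b : R) : (forall x : R, is_derive x 1 f (df x)) ->
  exists xi, `|xi - a| <= `|b - a| /\ f b - f a = df xi * (b - a).
Proof.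
move=> fd; have [ab|ba] := leP a b.
  have [x /[!in_itv]/= /andP[ax xb] e] := MVT_segment ab (fun x _ => fd x) (der_within (A := _) fd).
  by exists x; split=> //; rewrite !ger0_norm ?subr_ge0// lerB.
have [x /[!in_itv]/= /andP[bx xa] e] := MVT_segment (ltW ba) (fun x _ => fd x) (der_within (A := _) fd).
exists x; split.
  by rewrite !(distrC _ a) !ger0_norm ?subr_ge0 ?(ltW ba)// lerB.
by apply: oppr_inj; rewrite opprB e -mulrN opprB.
Qed.

Lemma C1_slice1 phi x y : Ck 1 phi ->
  is_derive (x : R) 1 (fun x => phi (x, y)) (pd1 phi (x, y)).
Proof.
move=> [_ [d1 _] _]; apply/is_derive_cvg.
have /is_derive_cvg := derivableP (d1 (x, y)).
suff E (h : R) : h *: ((1, 0) : plane R) + (x, y) = (h%:A + x, y).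
  by under eq_fun do rewrite E.
by congr pair; rewrite /= [h *: 0]mulr0 add0r.
Qed.

Lemma C1_slice2 phi x y : Ck 1 phi ->
  is_derive (y : R) 1 (fun y => phi (x, y)) (pd2 phi (x, y)).
Proof.
move=> [_ _ [d2 _]]; apply/is_derive_cvg.
have /is_derive_cvg := derivableP (d2 (x, y)).
suff E (h : R) : h *: ((0, 1) : plane R) + (x, y) = (x, h%:A + y).
  by under eq_fun do rewrite E.
by congr pair; rewrite /= [h *: 0]mulr0 add0r.
Qed.

(** The increment is split into a horizontal and a vertical one, to which the mean
   value theorem applies; the partial derivatives are continuous. *)
Lemma C1_line phi (p v : plane R) (s : R) : Ck 1 phi ->
  is_derive s 1 (fun s => phi (p.1 + s * v.1, p.2 + s * v.2))
   (v.1 * pd1 phi (p.1 + s * v.1, p.2 + s * v.2) +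
    v.2 * pd2 phi (p.1 + s * v.1, p.2 + s * v.2)).
Proof.
move=> phi1; have [_ [_ c1] [_ c2]] := phi1.
set q1 := p.1 + s * v.1; set q2 := p.2 + s * v.2.
have /choice[xi hxi] : forall h : R, exists x : R, `|x - q1| <= `|h * v.1| /\
    phi (q1 + h * v.1, q2 + h * v.2) - phi (q1, q2 + h * v.2) =
    pd1 phi (x, q2 + h * v.2) * (h * v.1).
  move=> h; have [x] := MVT_between q1 (q1 + h * v.1)
    (fun x => C1_slice1 x (q2 + h * v.2) phi1).
  by rewrite [q1 + _ - q1]addrC addKr => hx; exists x.
have /choice[eta heta] : forall h : R, exists y : R, `|y - q2| <= `|h * v.2| /\
    phi (q1, q2 + h * v.2) - phi (q1, q2) = pd2 phi (q1, y) * (h * v.2).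
  move=> h; have [y] := MVT_between q2 (q2 + h * v.2) (fun y => C1_slice2 q1 y phi1).
  by rewrite [q2 + _ - q2]addrC addKr => hy; exists y.
have lin (k : R) : h * k @[h --> 0^'] --> (0 : R).
  rewrite -[X in _ --> X](mul0r k).
  by apply: cvgM; [exact: cvg_within|exact: cvg_cst].
have squeeze (z : R -> R) (a k : R) : (forall h, `|z h - a| <= `|h * k|) ->
    z h @[h --> 0^'] --> a.
  move=> zk; apply/cvgrPdist_lt => e e0.
  have /cvgrPdist_lt/(_ e e0) := lin k; apply: filterS => h.
  by rewrite sub0r normrN distrC; exact: le_lt_trans.
have cxi := squeeze xi q1 v.1 (fun h => (hxi h).1).
have ceta := squeeze eta q2 v.2 (fun h => (heta h).1).
have cq2 : q2 + h * v.2 @[h --> 0^'] --> q2.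
  rewrite -[X in _ --> X]addr0; apply: cvgD; [exact: cvg_cst|exact: lin].
have comp (g : plane R -> R) (f1 f2 : R -> R) : continuous g ->
    f1 h @[h --> 0^'] --> q1 -> f2 h @[h --> 0^'] --> q2 ->
    g (f1 h, f2 h) @[h --> 0^'] --> g (q1, q2).
  move=> cg h1 h2; apply: continuous_cvg; first exact: cg.
  exact: (@cvg_pair _ _ _ _ (nbhs q1) (nbhs q2)).
have e1 := comp _ _ _ c1 cxi cq2.
have e2 : pd2 phi (q1, eta h) @[h --> 0^'] --> pd2 phi (q1, q2).
  by apply: comp c2 _ ceta; apply: cvg_cst.
apply/is_derive_cvg.
have : v.1 * pd1 phi (xi h, q2 + h * v.2) + v.2 * pd2 phi (q1, eta h) @[h --> 0^'] -->
    v.1 * pd1 phi (q1, q2) + v.2 * pd2 phi (q1, q2).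
  by apply: cvgD; [apply: (cvgM (cvg_cst v.1) e1)|apply: (cvgM (cvg_cst v.2) e2)].
apply: cvg_trans; apply: near_eq_cvg; near=> h.
have h0 : h != 0 by near: h; exact: nbhs_dnbhs_neq.
have E a b c : a + (h%:A + s) * c = (a + s * c) + h * c + b - b.
  by rewrite [h%:A]mulr1; ring.
rewrite !(E _ 0) !subr0 !addr0 -/q1 -/q2 /GRing.scale /=.
have -> : phi (q1 + h * v.1, q2 + h * v.2) - phi (q1, q2) =
  (phi (q1 + h * v.1, q2 + h * v.2) - phi (q1, q2 + h * v.2)) +
  (phi (q1, q2 + h * v.2) - phi (q1, q2)) by ring.
rewrite (hxi h).2 (heta h).2; by field.
Unshelve. all: by end_near. Qed.

Lemma C1_rotation1 phi theta x y : Ck 1 phi ->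
  is_derive (x : R) 1 (fun x => phi (rotation theta (x, y)))
   (cos theta * pd1 phi (rotation theta (x, y)) +
    sin theta * pd2 phi (rotation theta (x, y))).
Proof.
move=> phi1.
have := C1_line (- (sin theta * y), cos theta * y) (cos theta, sin theta) x phi1.
rewrite /rotation /=.
have E z : (- (sin theta * y) + z * cos theta, cos theta * y + z * sin theta) =
    (cos theta * z - sin theta * y, sin theta * z + cos theta * y).
  by congr pair; ring.
by rewrite E; under eq_fun do rewrite E.
Qed.

Lemma C1_rotation2 phi theta x y : Ck 1 phi ->
  is_derive (y : R) 1 (fun y => phi (rotation theta (x, y)))
   (- sin theta * pd1 phi (rotation theta (x, y)) +
    cos theta * pd2 phi (rotation theta (x, y))).
Proof.
move=> phi1.
have := C1_line (cos theta * x, sin theta * x) (- sin theta, cos theta) y phi1.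
rewrite /rotation /=.
have E z : (cos theta * x + z * - sin theta, sin theta * x + z * cos theta) =
    (cos theta * x - sin theta * z, sin theta * x + cos theta * z).
  by congr pair; ring.
by rewrite E; under eq_fun do rewrite E.
Qed.

End ChainRule.

(** * The Robin form of a rectangle *)

Section RectangleForm.
Variable R : realType.
Implicit Types (F psi : plane R -> R).

Definition boxint (l r b t : R) F : R :=
  segint l r (fun x => segint b t (fun y => F (x, y))).

Lemma boxint_swap (l r b t : R) F : continuous F ->
  boxint l r b t F = segint b t (fun y => segint l r (fun x => F (x, y))).
Proof.
by move=> cF; apply: EFin_inj; rewrite -box_integral12// box_integral21.
Qed.

Lemma segint_param_continuous2 (l r : R) F : continuous F ->
  continuous (fun y => segint l r (fun x => F (x, y))).
Proof.
move=> cF; have cG : continuous (fun p : plane R => F (p.2, p.1)) by cts.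
exact: (segint_param_continuous (F := fun p => F (p.2, p.1)) cG).
Qed.

Lemma boxintD (l r b t : R) F G : continuous F -> continuous G ->
  boxint l r b t (fun p => F p + G p) = boxint l r b t F + boxint l r b t G.
Proof.
move=> cF cG; rewrite /boxint -segintD; [|exact: segint_param_continuous..].
by apply: eq_segint => x; rewrite segintD//; exact: slice2_continuous.
Qed.

Section Form.
Variables (alpha l r b t mu1 nu1 mu2 nu2 : R) (X dX X' dX' Y dY Y' dY' : R -> R).
Hypotheses (lr : l < r) (bt : b < t).
Hypothesis im1 : interval_modes alpha l r mu1 nu1 X dX X' dX'.
Hypothesis im2 : interval_modes alpha b t mu2 nu2 Y dY Y' dY'.

Let N1 := segint l r (fun x => X x ^+ 2).
Let N2 := segint b t (fun y => Y y ^+ 2).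

Definition boundary_form (l r b t : R) psi : R :=
  segint b t (fun y => psi (l, y) ^+ 2 + psi (r, y) ^+ 2) +
  segint l r (fun x => psi (x, b) ^+ 2 + psi (x, t) ^+ 2).

Section Projections.
Variable psi : plane R -> R.
Hypothesis cpsi : continuous psi.
Let cX : continuous X := im_cX im1.
Let cY : continuous Y := im_cX im2.
Let g y := segint l r (fun x => psi (x, y) * X x).
Let k x := segint b t (fun y => psi (x, y) * Y y).
Let w := boxint l r b t (fun p => psi p * (X p.1 * Y p.2)).
Let n := boxint l r b t (fun p => psi p ^+ 2).

Lemma projection1_continuous : continuous g.
Proof. by apply: (@segint_param_continuous2 l r (fun p => psi p * X p.1)); cts. Qed.

Lemma projection2_continuous : continuous k.
Proof. by apply: (@segint_param_continuous R (fun p => psi p * Y p.2) b t); cts. Qed.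

(** With [P] and [P'] the projections onto the first mode in each variable, the
   difference of the two sides is the squared norm of [(1 - P') (1 - P) psi]. *)
Lemma projections_inequality :
  n - w ^+ 2 / (N1 * N2) <=
  (n - segint b t (fun y => g y ^+ 2) / N1) + (n - segint l r (fun x => k x ^+ 2) / N2).
Proof.
have cg := projection1_continuous; have ck := projection2_continuous.
pose rho (p : plane R) := psi p - g p.2 / N1 * X p.1.
have crho : continuous rho by rewrite /rho; cts.
(* [rho] is [(1 - P) psi]. *)
have rho_norm : boxint l r b t (fun p => rho p ^+ 2) =
    n - segint b t (fun y => g y ^+ 2) / N1.
  rewrite /n !boxint_swap; [|by cts..].
  rewrite -segintZr -?segintB; [| |by cts|by cts]; last first.
    by apply: (@segint_param_continuous2 l r (fun p => psi p ^+ 2)); cts.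
  apply: eq_segint => y.
  have cs : continuous (fun x => psi (x, y)) by cts.
  by rewrite -(norm_subr_projection lr im1 cs).
have kw : segint l r (fun x => k x * X x) = w.
  rewrite /w /boxint; apply: eq_segint => x.
  rewrite -segintZr; last by cts.
  by apply: eq_segint => y; ring.
have gw : segint b t (fun y => g y * Y y) = w.
  rewrite /w boxint_swap; last by cts.
  apply: eq_segint => y; rewrite -segintZr; last by cts.
  by apply: eq_segint => x; ring.
have rho_proj x : segint b t (fun y => rho (x, y) * Y y) = k x - w / N1 * X x.
  rewrite -gw /k; have -> : segint b t (fun y => g y * Y y) / N1 * X x =
      segint b t (fun y => g y * Y y) * (X x / N1) by ring.
  rewrite -segintZr -?segintB; [|by cts..].
  by apply: eq_segint => y; rewrite /rho /=; ring.
have : segint l r (fun x => (k x - w / N1 * X x) ^+ 2 / N2) <=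
    boxint l r b t (fun p => rho p ^+ 2).
  apply: segint_le => [||x _]; first by cts.
    by apply: (@segint_param_continuous R (fun p => rho p ^+ 2)); cts.
  rewrite -rho_proj; apply: (cauchy_schwarz_mode bt im2 (f := fun y => rho (x, y))).
  by cts.
rewrite rho_norm segintZr; last by cts.
have := norm_subr_projection lr im1 ck; rewrite /= kw => ->; rewrite -/N1.
have -> : w ^+ 2 / (N1 * N2) = w ^+ 2 / N1 / N2 by rewrite invfM mulrA.
by rewrite mulrBl; lra.
Qed.

End Projections.

Variables psi psi1 psi2 : plane R -> R.
Hypotheses (cpsi : continuous psi) (cpsi1 : continuous psi1) (cpsi2 : continuous psi2).
Hypothesis d1 : forall x y : R, is_derive x 1 (fun x => psi (x, y)) (psi1 (x, y)).
Hypothesis d2 : forall x y : R, is_derive y 1 (fun y => psi (x, y)) (psi2 (x, y)).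
Let g y := segint l r (fun x => psi (x, y) * X x).
Let k x := segint b t (fun y => psi (x, y) * Y y).

Let n := boxint l r b t (fun p => psi p ^+ 2).
Let w := boxint l r b t (fun p => psi p * (X p.1 * Y p.2)).
Let q := boxint l r b t (fun p => psi1 p ^+ 2 + psi2 p ^+ 2) +
  alpha * boundary_form l r b t psi.
Let defect1 := n - segint b t (fun y => g y ^+ 2) / N1.
Let defect2 := n - segint l r (fun x => k x ^+ 2) / N2.

Lemma defect1_ge0 : 0 <= defect1.
Proof.
have cg := projection1_continuous cpsi.
rewrite /defect1 /n subr_ge0 boxint_swap; last by cts.
rewrite -segintZr; last by cts.
apply: segint_le => [||y _]; first by cts.
  by apply: (@segint_param_continuous2 l r (fun p => psi p ^+ 2)); cts.
by apply: (cauchy_schwarz_mode lr im1); cts.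
Qed.

Lemma defect2_ge0 : 0 <= defect2.
Proof.
have ck := projection2_continuous cpsi.
rewrite /defect2 /n subr_ge0 -segintZr; last by cts.
apply: segint_le => [||x _]; first by cts.
  by apply: (@segint_param_continuous R (fun p => psi p ^+ 2)); cts.
by apply: (cauchy_schwarz_mode bt im2); cts.
Qed.

(** [robin_gap_inequality] on every horizontal and every vertical slice. *)
Lemma rect_form_defects :
  (nu1 - mu1) * defect1 + (nu2 - mu2) * defect2 <= q - (mu1 + mu2) * n.
Proof.
have cg := projection1_continuous cpsi; have ck := projection2_continuous cpsi.
have cn1 : continuous (fun y => segint l r (fun x => psi (x, y) ^+ 2)).
  by apply: (@segint_param_continuous2 l r (fun p => psi p ^+ 2)); cts.
have cq1 : continuous (fun y => segint l r (fun x => psi1 (x, y) ^+ 2)).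
  by apply: (@segint_param_continuous2 l r (fun p => psi1 p ^+ 2)); cts.
have cn2 : continuous (fun x => segint b t (fun y => psi (x, y) ^+ 2)).
  by apply: (@segint_param_continuous R (fun p => psi p ^+ 2)); cts.
have cq2 : continuous (fun x => segint b t (fun y => psi2 (x, y) ^+ 2)).
  by apply: (@segint_param_continuous R (fun p => psi2 p ^+ 2)); cts.
set N1i := N1^-1; set N2i := N2^-1.
have h1 : segint b t (fun y => (nu1 - mu1) *
      (segint l r (fun x => psi (x, y) ^+ 2) - g y ^+ 2 * N1i)) <=
    segint b t (fun y => segint l r (fun x => psi1 (x, y) ^+ 2) +
      alpha * (psi (l, y) ^+ 2 + psi (r, y) ^+ 2) -
      mu1 * segint l r (fun x => psi (x, y) ^+ 2)).
  apply: segint_le => [||y _]; [by cts|by cts|].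
  by apply: (robin_gap_inequality lr im1 (f := fun x => psi (x, y))
    (df := fun x => psi1 (x, y))) => //; cts.
have h2 : segint l r (fun x => (nu2 - mu2) *
      (segint b t (fun y => psi (x, y) ^+ 2) - k x ^+ 2 * N2i)) <=
    segint l r (fun x => segint b t (fun y => psi2 (x, y) ^+ 2) +
      alpha * (psi (x, b) ^+ 2 + psi (x, t) ^+ 2) -
      mu2 * segint b t (fun y => psi (x, y) ^+ 2)).
  apply: segint_le => [||x _]; [by cts|by cts|].
  by apply: (robin_gap_inequality bt im2 (f := fun y => psi (x, y))
    (df := fun y => psi2 (x, y))) => //; cts.
have E1 : segint b t (fun y => segint l r (fun x => psi1 (x, y) ^+ 2)) =
  boxint l r b t (fun p => psi1 p ^+ 2) by rewrite boxint_swap//; cts.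
have E2 : segint b t (fun y => segint l r (fun x => psi (x, y) ^+ 2)) = n
  by rewrite /n boxint_swap//; cts.
have E3 : segint l r (fun x => segint b t (fun y => psi2 (x, y) ^+ 2)) =
  boxint l r b t (fun p => psi2 p ^+ 2) := erefl.
have E4 : segint l r (fun x => segint b t (fun y => psi (x, y) ^+ 2)) = n := erefl.
move: h1 h2.
rewrite !segintZ ?segintB ?segintZr ?segintZ ?segintD ?segintZ ?E1 ?E2 ?E3 ?E4; [|by cts..].
rewrite /defect1 /defect2 /q boxintD; [|by cts..].
rewrite /boundary_form !segintD; [|by cts..].
move=> h1 h2; apply: le_trans (lerD h1 h2) _.
by rewrite le_eqVlt; apply/orP; left; apply/eqP; ring.
Qed.

(** [w] is the component of [psi] along the product of the first modes, on whose
   orthogonal complement the second inequality bounds the second eigenvalue. *)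
Lemma rect_form_lower : (mu1 + mu2) * n <= q /\
  Num.min (nu1 - mu1) (nu2 - mu2) * (n - w ^+ 2 / (N1 * N2)) <= q - (mu1 + mu2) * n.
Proof.
have h := rect_form_defects.
have p1 := defect1_ge0; have p2 := defect2_ge0.
have g1 : 0 < nu1 - mu1 by rewrite subr_gt0 (im_gap im1).
have g2 : 0 < nu2 - mu2 by rewrite subr_gt0 (im_gap im2).
split.
  rewrite -subr_ge0; apply: le_trans h.
  by rewrite addr_ge0// mulr_ge0// ltW.
have g0 : 0 < Num.min (nu1 - mu1) (nu2 - mu2) by rewrite lt_min g1.
apply: le_trans h.
apply: (@le_trans _ _ (Num.min (nu1 - mu1) (nu2 - mu2) * (defect1 + defect2))).
  by rewrite ler_pM2l//; exact: (projections_inequality cpsi).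
rewrite mulrDr; apply: lerD; apply: ler_wpM2r => //.
  by rewrite ge_min lexx.
by rewrite ge_min lexx orbT.
Qed.

End Form.
End RectangleForm.

(** * Limits in mean square *)

Section L2Limits.
Context d (T : measurableType d) (R : realType).
Variables (mu : {measure set T -> \bar R}) (D : set T).
Hypothesis mD : measurable D.
Implicit Types (f g : T -> R).

Definition L2dot f g : R := (\int[mu]_(x in D) (f x * g x))%R.
Definition L2sq f : R := (\int[mu]_(x in D) (f x ^+ 2))%R.

Lemma L2_dot_integrable f g : L2 mu D f -> L2 mu D g ->
  mu.-integrable D (fun x => (f x * g x)%:E).
Proof.
move=> [mf f2] [mg g2].
apply: (le_integrable mD _ _ (integrableD mD f2 g2)).
  by apply/measurable_EFinP; exact: measurable_funM.
move=> x _; rewrite /= lee_fin normrM [leRHS]ger0_norm; last by rewrite addr_ge0// sqr_ge0.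
rewrite -[f x ^+ 2]real_normK ?num_real// -[g x ^+ 2]real_normK ?num_real//.
have := sqr_ge0 (`|f x| - `|g x|); have := normr_ge0 (f x); have := normr_ge0 (g x); nra.
Qed.

Lemma L2_lincomb (a b : R) f g : L2 mu D f -> L2 mu D g ->
  L2 mu D (fun x => a * f x + b * g x).
Proof.
move=> hf hg; have [mf f2] := hf; have [mg g2] := hg.
have mh : measurable_fun D (fun x => a * f x + b * g x).
  by apply: measurable_funD; apply: measurable_funM.
split=> //.
have -> : (fun x => ((a * f x + b * g x) ^+ 2)%:E) =
   (fun x => (a ^+ 2)%:E * (f x ^+ 2)%:E + ((2 * a * b)%:E * (f x * g x)%:E
     + (b ^+ 2)%:E * (g x ^+ 2)%:E))%E.
  by apply/funext => x; rewrite -!EFinM -!EFinD; congr EFin; ring.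
apply: integrableD => //; first exact: integrableZl.
apply: integrableD => //; last exact: integrableZl.
by apply: integrableZl => //; exact: L2_dot_integrable.
Qed.

Lemma L2_sub f g : L2 mu D f -> L2 mu D g -> L2 mu D (fun x => f x - g x).
Proof.
move=> hf hg; have := L2_lincomb 1 (-1) hf hg.
by congr (L2 mu D _); apply/funext => x; rewrite mul1r mulN1r.
Qed.

Lemma L2sqE f : L2 mu D f -> (\int[mu]_(x in D) (f x ^+ 2)%:E)%E = (L2sq f)%:E.
Proof. by move=> [mf f2]; rewrite fineK//; exact: integrable_fin_num. Qed.

Lemma L2sq_ge0 f : 0 <= L2sq f.
Proof. by apply: Rintegral_ge0 => x _; exact: sqr_ge0. Qed.

Lemma L2sq_eq0 f : L2 mu D f -> L2sq f = 0 ->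
  {ae mu, forall x, D x -> f x = 0}.
Proof.
move=> [mf f2] f0.
have : (\int[mu]_(x in D) `|(f x ^+ 2)%:E| = 0)%E.
  under eq_integral do rewrite gee0_abs ?lee_fin ?sqr_ge0//.
  by rewrite L2sqE// f0.
move/ae_eq_integral_abs => /(_ mD) [].
  by apply/measurable_EFinP; exact: measurable_funX.
move=> N [mN N0 sub]; exists N; split=> // x /= fx; apply: sub => /= h; apply: fx => Dx.
by apply/eqP; rewrite -sqrf_eq0; apply/eqP; have [] := h Dx.
Qed.

(** The shape in which Young's inequality, with its free parameter [e], bounds the
   errors below; it takes the place of the Cauchy-Schwarz inequality. *)
Lemma cvg_from_error (a x : nat -> R) (l C : R) (K : R -> R) : 0 <= C ->
  (forall e, 0 < e -> forall n, `|x n - l| <= e * C + K e * a n) ->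
  a n @[n --> \oo] --> 0 -> x n @[n --> \oo] --> l.
Proof.
move=> C0 h a0; apply/cvgrPdist_lt => e e0.
pose e' := e / (2 * (C + 1)).
have e'0 : 0 < e' by rewrite divr_gt0// mulr_gt0//; lra.
have : K e' * a n @[n --> \oo] --> 0.
  rewrite -[X in _ --> X](mulr0 (K e')); apply: cvgM => //; exact: cvg_cst.
have e2 : 0 < e / 2 by rewrite divr_gt0.
move=> /cvgrPdist_lt/(_ _ e2); apply: filterS => n; rewrite sub0r normrN => an.
rewrite distrC; apply: le_lt_trans (h _ e'0 n) _.
have : e' * C <= e / 2.
  rewrite /e' invfM mulrA -mulrA ler_piMr ?(ltW e2)//.
  by rewrite mulrC ler_pdivrMr; lra.
have := ler_norm (K e' * a n); lra.
Qed.

Lemma L2sq_perturb f g e : L2 mu D f -> L2 mu D g -> 0 < e ->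
  `|L2sq f - L2sq g| <= e * L2sq g + (1 + e^-1) * L2sq (fun x => f x - g x).
Proof.
move=> hf hg e0; have hd := L2_sub hf hg.
have [mf f2] := hf; have [mg g2] := hg; have [md d2] := hd.
have id : mu.-integrable D (EFin \o (fun x => f x ^+ 2 - g x ^+ 2)).
  by have := integrableB mD f2 g2.
rewrite /L2sq -RintegralB//; apply: le_trans (le_normr_Rintegral mD id) _.
rewrite -!RintegralZl// -RintegralD//; last 2 first.
- by have := integrableZl mD e g2.
- by have := integrableZl mD (1 + e^-1) d2.
apply: le_Rintegral => //.
- by have := integrable_abse id.
- by have := integrableD mD (integrableZl mD e g2) (integrableZl mD (1 + e^-1) d2).
move=> x _.
have -> : f x ^+ 2 - g x ^+ 2 = (f x - g x) ^+ 2 + 2 * (f x - g x) * g x by ring.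
apply: le_trans (ler_normD _ _) _; rewrite ger0_norm ?sqr_ge0//.
set v := g x; set z := f x - g x.
have -> : e * v ^+ 2 + (1 + e^-1) * z ^+ 2 = z ^+ 2 + (e * v ^+ 2 + e^-1 * z ^+ 2) by ring.
rewrite lerD2l.
have -> : e * v ^+ 2 + e^-1 * z ^+ 2 = `|2 * z * v| + e * (`|v| - e^-1 * `|z|) ^+ 2.
  rewrite !normrM ger0_norm// -[v ^+ 2]real_normK ?num_real// -[z ^+ 2]real_normK ?num_real//.
  by field; rewrite gt_eqF.
by rewrite lerDl mulr_ge0 ?sqr_ge0// ltW.
Qed.

Lemma L2dot_perturb f g h e : L2 mu D f -> L2 mu D g -> L2 mu D h -> 0 < e ->
  `|L2dot f h - L2dot g h| <= e * L2sq h + e^-1 * L2sq (fun x => f x - g x).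
Proof.
move=> hf hg hh e0; have hd := L2_sub hf hg.
have [md d2] := hd; have [mh h2] := hh.
have ifh := L2_dot_integrable hf hh; have igh := L2_dot_integrable hg hh.
have id : mu.-integrable D (EFin \o (fun x => f x * h x - g x * h x)).
  by have := integrableB mD ifh igh.
rewrite /L2sq /L2dot -RintegralB//; apply: le_trans (le_normr_Rintegral mD id) _.
rewrite -!RintegralZl// -RintegralD//; last 2 first.
- by have := integrableZl mD e h2.
- by have := integrableZl mD e^-1 d2.
apply: le_Rintegral => //.
- by have := integrable_abse id.
- by have := integrableD mD (integrableZl mD e h2) (integrableZl mD e^-1 d2).
move=> x _; rewrite -mulrBl.
set v := h x; set z := f x - g x.
have -> : e * v ^+ 2 + e^-1 * z ^+ 2 = `|z * v| + (`|z * v| + e * (`|v| - e^-1 * `|z|) ^+ 2).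
  rewrite !normrM -[v ^+ 2]real_normK ?num_real// -[z ^+ 2]real_normK ?num_real//.
  by field; rewrite gt_eqF.
by rewrite lerDl addr_ge0// mulr_ge0 ?sqr_ge0// ltW.
Qed.

Section Sequence.
Variables (F : nat -> T -> R) (f : T -> R).
Hypothesis hF : forall n, L2 mu D (F n).
Hypothesis hf : L2 mu D f.
Hypothesis Ff : (\int[mu]_(x in D) ((F n x - f x) ^+ 2)%:E)%E @[n --> \oo] --> 0%E.

Let err : L2sq (fun x => F n x - f x) @[n --> \oo] --> 0.
Proof. exact: (fine_cvg Ff). Qed.

Lemma L2sq_cvg : L2sq (F n) @[n --> \oo] --> L2sq f.
Proof.
apply: (cvg_from_error (K := fun e => 1 + e^-1) (L2sq_ge0 f) _ err) => e e0 n.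
exact: L2sq_perturb.
Qed.

Lemma L2dot_cvg h : L2 mu D h -> L2dot (F n) h @[n --> \oo] --> L2dot f h.
Proof.
move=> hh; apply: (cvg_from_error (K := fun e => e^-1) (L2sq_ge0 h) _ err) => e e0 n.
exact: L2dot_perturb.
Qed.
End Sequence.

Lemma L2_cvg_lincomb (a b : R) (F G : nat -> T -> R) f g :
  (forall n, L2 mu D (F n)) -> L2 mu D f -> (forall n, L2 mu D (G n)) -> L2 mu D g ->
  (\int[mu]_(x in D) ((F n x - f x) ^+ 2)%:E)%E @[n --> \oo] --> 0%E ->
  (\int[mu]_(x in D) ((G n x - g x) ^+ 2)%:E)%E @[n --> \oo] --> 0%E ->
  (\int[mu]_(x in D) (((a * F n x + b * G n x) - (a * f x + b * g x)) ^+ 2)%:E)%E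
    @[n --> \oo] --> 0%E.
Proof.
move=> hF hf hG hg Ff Gg.
have hdF n := L2_sub (hF n) hf; have hdG n := L2_sub (hG n) hg.
have E n : (fun x => (a * F n x + b * G n x) - (a * f x + b * g x)) =
    (fun x => a * (F n x - f x) + b * (G n x - g x)) by apply/funext => x; ring.
have hc n : L2 mu D (fun x => (a * F n x + b * G n x) - (a * f x + b * g x)).
  by rewrite E; exact: L2_lincomb.
under eq_fun do rewrite (L2sqE (hc _)).
apply: cvg_EFin; first by apply: nearW => n.
have h0 : 2 * a ^+ 2 * L2sq (fun x => F n x - f x) + 2 * b ^+ 2 * L2sq (fun x => G n x - g x)
    @[n --> \oo] --> 0.
  rewrite -[X in _ --> X]addr0; apply: cvgD.
    rewrite -[X in _ --> X](mulr0 (2 * a ^+ 2)); apply: cvgM; [exact: cvg_cst|exact: (fine_cvg Ff)].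
  rewrite -[X in _ --> X](mulr0 (2 * b ^+ 2)); apply: cvgM; [exact: cvg_cst|exact: (fine_cvg Gg)].
apply: (squeeze_cvgr _ (cvg_cst 0) h0); apply: nearW => n /=; rewrite L2sq_ge0/=.
have [_ i1] := hdF n; have [_ i2] := hdG n; have [_ i3] := hc n.
rewrite /L2sq -!RintegralZl// -RintegralD//; last 2 first.
- by have := integrableZl mD (2 * a ^+ 2) i1.
- by have := integrableZl mD (2 * b ^+ 2) i2.
apply: le_Rintegral => //.
  by have := integrableD mD (integrableZl mD (2 * a ^+ 2) i1) (integrableZl mD (2 * b ^+ 2) i2).
move=> x _; have -> : a * F n x + b * G n x - (a * f x + b * g x) =
  a * (F n x - f x) + b * (G n x - g x) by ring.
rewrite -subr_ge0.
have -> : 2 * a ^+ 2 * (F n x - f x) ^+ 2 + 2 * b ^+ 2 * (G n x - g x) ^+ 2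
  - (a * (F n x - f x) + b * (G n x - g x)) ^+ 2 =
  (a * (F n x - f x) - b * (G n x - g x)) ^+ 2 by ring.
exact: sqr_ge0.
Qed.

End L2Limits.

(** * Lower bounds on the Sobolev space *)

Section H1Lower.
Variable R : realType.
Local Notation mu := (@lebesgue_measure R).
Local Notation leb2 := (@lebesgue2 R).
Variable Q : rectangle R.
Implicit Types (phi psi u v t F : plane R -> R).
Local Notation l := (rleft Q).
Local Notation r := (rright Q).
Local Notation b := (rbottom Q).
Local Notation tp := (rtop Q).
Local Notation rho := (rotation (rangle Q)).

Let lr : l < r := rleft_lt_rright Q.
Let bt : b < tp := rbottom_lt_rtop Q.
Let mQ := rect_measurable Q.

Lemma edge_range_measurable e : measurable (edge_range Q e : set (measurableTypeR R)).
Proof. by rewrite /edge_range; case: ifP => _; exact: measurable_itv. Qed.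

Lemma edge_continuous e : continuous (edge Q e).
Proof.
rewrite /edge; apply: (cts_comp (f := fun s : R => if e.1 then
    (s, if e.2 then rtop Q else rbottom Q) else (if e.2 then rright Q else rleft Q, s))).
  by case: e.1; cts.
exact: rotation_continuous.
Qed.

Lemma continuous_rect_L2 F : continuous F -> L2 leb2 (rect_set Q) F.
Proof.
move=> cF; split; first by apply: measurable_funTS; exact: plane_continuous_measurable.
by apply: (@rect_integrable R Q (fun p => F p ^+ 2)); cts.
Qed.

Lemma continuous_boundary_L2 F : continuous F -> boundary_L2 Q F.
Proof.
move=> cF e; have cG : continuous (fun s => F (edge Q e s)).
  exact: (cts_comp (@edge_continuous e) cF).
split; first by apply: measurable_funTS; exact: continuous_measurable_fun.
have cG2 : continuous (fun s => F (edge Q e s) ^+ 2) by apply: ctsX.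
by rewrite /edge_range; case: ifP => _; exact: (segint_integrable _ _ cG2).
Qed.

Definition boundary_sq t : R :=
  \sum_(e : bool * bool) L2sq mu (edge_range Q e) (fun s => t (edge Q e s)).

Lemma boundary_sqE t : boundary_L2 Q t ->
  rect_boundary_integral Q (fun p => (t p ^+ 2)%:E) = (boundary_sq t)%:E.
Proof.
move=> ht; rewrite /rect_boundary_integral /boundary_sq -sumEFin.
by apply: eq_bigr => e _; rewrite (L2sqE (edge_range_measurable e) (ht e)).
Qed.

(** What the lower bounds use of an element of [H^1].  Unlike [H1], a predicate on
   functions makes its stability under linear combinations easy to state. *)
Definition h1_data u (u1 u2 : plane R -> R) t : Prop :=
  [/\ [/\ L2 leb2 (rect_set Q) u, L2 leb2 (rect_set Q) u1 & L2 leb2 (rect_set Q) u2],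
      boundary_L2 Q t & is_trace Q u u1 u2 t].

Lemma H1_data (v : H1 Q) : h1_data (h1_fun v) (h1_d1 v) (h1_d2 v) (h1_trace v).
Proof. by case: v => *; split. Qed.

(** The four edge integrals are nonnegative, so each is bounded by their sum. *)
Lemma trace_edge_cvg (phi : nat -> plane R -> R) t e :
  (forall n, continuous (phi n)) -> boundary_L2 Q t ->
  rect_boundary_integral Q (fun p => ((phi n p - t p) ^+ 2)%:E) @[n --> \oo] --> 0%E ->
  (\int[mu]_(s in edge_range Q e) ((phi n (edge Q e s) - t (edge Q e s)) ^+ 2)%:E)%E
    @[n --> \oo] --> 0%E.
Proof.
move=> cphi ht h.
have h0 (e' : bool * bool) n : (0 <= \int[mu]_(s in edge_range Q e')
    ((phi n (edge Q e' s) - t (edge Q e' s)) ^+ 2)%:E)%E.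
  by apply: integral_ge0 => s _; rewrite lee_fin sqr_ge0.
apply: (squeeze_cvge _ (cvg_cst 0%E) h); apply: nearW => n.
rewrite h0/= /rect_boundary_integral (bigD1 e)//= leeDl//.
by apply: sume_ge0 => e' _; exact: h0.
Qed.

Lemma pd1_lincomb (a c : R) phi psi : Ck 1 phi -> Ck 1 psi ->
  pd1 (fun p => a * phi p + c * psi p) = (fun p => a * pd1 phi p + c * pd1 psi p).
Proof.
move=> [_ [d1 _] _] [_ [e1 _] _]; apply/funext => p; rewrite /pd1.
have := @is_deriveD R _ _ (a \*: phi) (c \*: psi) p (1, 0) _ _
  (@is_deriveZ R _ _ phi a p (1, 0) _ (derivableP (d1 p)))
  (@is_deriveZ R _ _ psi c p (1, 0) _ (derivableP (e1 p))).
by case.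
Qed.

Lemma pd2_lincomb (a c : R) phi psi : Ck 1 phi -> Ck 1 psi ->
  pd2 (fun p => a * phi p + c * psi p) = (fun p => a * pd2 phi p + c * pd2 psi p).
Proof.
move=> [_ _ [d1 _]] [_ _ [e1 _]]; apply/funext => p; rewrite /pd2.
have := @is_deriveD R _ _ (a \*: phi) (c \*: psi) p (0, 1) _ _
  (@is_deriveZ R _ _ phi a p (0, 1) _ (derivableP (d1 p)))
  (@is_deriveZ R _ _ psi c p (0, 1) _ (derivableP (e1 p))).
by case.
Qed.

Lemma C1_lincomb (a c : R) phi psi : Ck 1 phi -> Ck 1 psi ->
  Ck 1 (fun p => a * phi p + c * psi p).
Proof.
move=> h k; have p1 := pd1_lincomb a c h k; have p2 := pd2_lincomb a c h k.
case: h k => [c0 [d1 c1] [d2 c2]] [c0' [d1' c1'] [d2' c2']].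
move: c1 c2 c1' c2'; rewrite /Ck => c1 c2 c1' c2'.
split; [by cts| |].
- split; last by rewrite p1; cts.
  by move=> p; apply: derivableD; apply: derivableZ.
- split; last by rewrite p2; cts.
  by move=> p; apply: derivableD; apply: derivableZ.
Qed.

Lemma C1_L2 phi : Ck 1 phi -> [/\ L2 leb2 (rect_set Q) phi,
  L2 leb2 (rect_set Q) (pd1 phi) & L2 leb2 (rect_set Q) (pd2 phi)].
Proof. by move=> [? [_ ?] [_ ?]]; split; exact: continuous_rect_L2. Qed.

Lemma h1_data_lincomb (a c : R) u (u1 u2 : plane R -> R) t v (v1 v2 s : plane R -> R) :
  h1_data u u1 u2 t -> h1_data v v1 v2 s ->
  h1_data (fun p => a * u p + c * v p) (fun p => a * u1 p + c * v1 p)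
    (fun p => a * u2 p + c * v2 p) (fun p => a * t p + c * s p).
Proof.
move=> [[hu hu1 hu2] ht [phi [C1phi pu pu1 pu2 pt]]].
move=> [[hv hv1 hv2] hs [psi [C1psi qv qv1 qv2 qs]]].
split; first by split; exact: L2_lincomb.
  by move=> e; exact: (L2_lincomb (edge_range_measurable e) a c (ht e) (hs e)).
exists (fun n p => a * phi n p + c * psi n p); split.
- by move=> n; exact: C1_lincomb.
- apply: (L2_cvg_lincomb mQ a c (F := phi) (G := psi)) => // n.
    by have [] := C1_L2 (C1phi n).
  by have [] := C1_L2 (C1psi n).
- under eq_fun do rewrite pd1_lincomb//.
  apply: (L2_cvg_lincomb mQ a c (F := fun n => pd1 (phi n)) (G := fun n => pd1 (psi n))) => // n.
    by have [] := C1_L2 (C1phi n).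
  by have [] := C1_L2 (C1psi n).
- under eq_fun do rewrite pd2_lincomb//.
  apply: (L2_cvg_lincomb mQ a c (F := fun n => pd2 (phi n)) (G := fun n => pd2 (psi n))) => // n.
    by have [] := C1_L2 (C1phi n).
  by have [] := C1_L2 (C1psi n).
- have cphi n : continuous (phi n) by have [] := C1phi n.
  have cpsi n : continuous (psi n) by have [] := C1psi n.
  pose err (e : bool * bool) n := (\int[mu]_(z in edge_range Q e)
    ((a * phi n (edge Q e z) + c * psi n (edge Q e z) -
      (a * t (edge Q e z) + c * s (edge Q e z))) ^+ 2)%:E)%E.
  have := @cvg_nnesum nat \oo _ R _ (index_enum _) err (fun=> 0%E) xpredT.
  rewrite big1//; apply=> e _.
    by apply: nearW => n; apply: integral_ge0 => z _; rewrite lee_fin sqr_ge0.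
  apply: (L2_cvg_lincomb (edge_range_measurable e) a c
    (F := fun n z => phi n (edge Q e z)) (G := fun n z => psi n (edge Q e z))
    (f := fun z => t (edge Q e z)) (g := fun z => s (edge Q e z))) => //.
  + by move=> n; exact: (continuous_boundary_L2 (cphi n) e).
  + by move=> n; exact: (continuous_boundary_L2 (cpsi n) e).
  + exact: trace_edge_cvg.
  + exact: trace_edge_cvg.
Qed.

Lemma boundary_sq_continuous F : continuous F ->
  boundary_sq F = boundary_form l r b tp (fun p => F (rho p)).
Proof.
move=> cF.
have cr := @rotation_continuous R (rangle Q).
rewrite /boundary_sq /boundary_form -(pair_bigA _ (fun i j =>
  L2sq mu (edge_range Q (i, j)) (fun s => F (edge Q (i, j) s)))) /= !big_bool /=.
rewrite /L2sq /edge_range /edge /=.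
rewrite !segintD; [|by cts..].
by rewrite /segint addrC; congr (_ + _); rewrite addrC.
Qed.

Lemma rect_integral_boxint F : continuous F ->
  (\int[leb2]_(p in rect_set Q) (F p)%:E)%E =
  (boxint l r b tp (fun p => F (rho p)))%:E.
Proof.
move=> cF; rewrite rect_change_of_variables// box_integral12//.
by exact: (cts_comp (@rotation_continuous R (rangle Q)) cF).
Qed.

Section Lower.
Variables (alpha mu1 nu1 mu2 nu2 : R) (X dX X' dX' Y dY Y' dY' : R -> R).
Hypothesis im1 : interval_modes alpha l r mu1 nu1 X dX X' dX'.
Hypothesis im2 : interval_modes alpha b tp mu2 nu2 Y dY Y' dY'.

(** A product of functions of the two coordinates along the sides of the
   rectangle. *)
Definition product_mode (f g : R -> R) (p : plane R) : R :=
  f (rotation (- rangle Q) p).1 * g (rotation (- rangle Q) p).2.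

Lemma product_mode_continuous f g : continuous f -> continuous g ->
  continuous (product_mode f g).
Proof.
move=> cf cg; have cr := @rotation_continuous R (- rangle Q).
by rewrite /product_mode; cts.
Qed.

Let N := segint l r (fun x => X x ^+ 2) * segint b tp (fun y => Y y ^+ 2).

Lemma rect_lower_C1 phi : Ck 1 phi ->
  let n := L2sq leb2 (rect_set Q) phi in
  let w := L2dot leb2 (rect_set Q) phi (product_mode X Y) in
  let q := L2sq leb2 (rect_set Q) (pd1 phi) + L2sq leb2 (rect_set Q) (pd2 phi)
    + alpha * boundary_sq phi in
  (mu1 + mu2) * n <= q /\
  Num.min (nu1 - mu1) (nu2 - mu2) * (n - w ^+ 2 / N) <= q - (mu1 + mu2) * n.
Proof.
move=> C1phi n w q; have [cphi [_ c1] [_ c2]] := C1phi.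
have cX := im_cX im1; have cY := im_cX im2.
have cr := @rotation_continuous R (rangle Q).
pose cs := cos (rangle Q); pose sn := sin (rangle Q).
pose psi p := phi (rho p).
pose psi1 p := cs * pd1 phi (rho p) + sn * pd2 phi (rho p).
pose psi2 p := - sn * pd1 phi (rho p) + cs * pd2 phi (rho p).
have cpsi : continuous psi by rewrite /psi; cts.
have cpsi1 : continuous psi1 by rewrite /psi1; cts.
have cpsi2 : continuous psi2 by rewrite /psi2; cts.
have nE : n = boxint l r b tp (fun p => psi p ^+ 2).
  by rewrite /n /L2sq /Rintegral (rect_integral_boxint (F := fun p => phi p ^+ 2)); [|cts].
have wE : w = boxint l r b tp (fun p => psi p * (X p.1 * Y p.2)).
  have ce := product_mode_continuous cX cY.
  rewrite /w /L2dot /Rintegral (rect_integral_boxint (F := fun p => phi p * product_mode X Y p)); [|by cts].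
  rewrite /=; congr boxint; apply/funext => p.
  by rewrite /product_mode rotationK.
have qE : q = boxint l r b tp (fun p => psi1 p ^+ 2 + psi2 p ^+ 2) +
    alpha * boundary_form l r b tp psi.
  rewrite /q boundary_sq_continuous//; congr (_ + _).
  rewrite /L2sq /Rintegral (rect_integral_boxint (F := fun p => pd1 phi p ^+ 2)); [|by cts].
  rewrite (rect_integral_boxint (F := fun p => pd2 phi p ^+ 2)); [|by cts].
  rewrite /= -boxintD; [|by cts..].
  congr boxint; apply/funext => p; have := cos2Dsin2 (rangle Q).
  rewrite /psi1 /psi2 -/cs -/sn => e.
  by rewrite -[LHS]mul1r -e; ring.
have := rect_form_lower lr bt im1 im2 cpsi cpsi1 cpsi2.
rewrite -nE -wE -qE; apply.
- by move=> x y; exact: C1_rotation1.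
- by move=> x y; exact: C1_rotation2.
Qed.

(** Every term of the inequality is continuous for the convergence in
   [is_trace]. *)
Lemma rect_lower_H1 u (u1 u2 : plane R -> R) t : h1_data u u1 u2 t ->
  let n := L2sq leb2 (rect_set Q) u in
  let w := L2dot leb2 (rect_set Q) u (product_mode X Y) in
  let q := L2sq leb2 (rect_set Q) u1 + L2sq leb2 (rect_set Q) u2
    + alpha * boundary_sq t in
  (mu1 + mu2) * n <= q /\
  Num.min (nu1 - mu1) (nu2 - mu2) * (n - w ^+ 2 / N) <= q - (mu1 + mu2) * n.
Proof.
move=> [[hu hu1 hu2] ht [phi [C1phi pu pu1 pu2 pt]]] n w q.
have cX := im_cX im1; have cY := im_cX im2.
have cphi k : continuous (phi k) by have [] := C1phi k.
have L k := C1_L2 (C1phi k).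
have nc : L2sq leb2 (rect_set Q) (phi k) @[k --> \oo] --> n.
  by apply: (L2sq_cvg mQ) => // k; have [] := L k.
have n1c : L2sq leb2 (rect_set Q) (pd1 (phi k)) @[k --> \oo] --> L2sq leb2 (rect_set Q) u1.
  by apply: (L2sq_cvg mQ (F := fun k => pd1 (phi k))) => // k; have [] := L k.
have n2c : L2sq leb2 (rect_set Q) (pd2 (phi k)) @[k --> \oo] --> L2sq leb2 (rect_set Q) u2.
  by apply: (L2sq_cvg mQ (F := fun k => pd2 (phi k))) => // k; have [] := L k.
have wc : L2dot leb2 (rect_set Q) (phi k) (product_mode X Y) @[k --> \oo] --> w.
  apply: (L2dot_cvg mQ) => //; first by move=> k; have [] := L k.
  by apply: continuous_rect_L2; exact: product_mode_continuous.
have bc : boundary_sq (phi k) @[k --> \oo] --> boundary_sq t.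
  rewrite /boundary_sq; apply: cvg_big => //; first exact: add_continuous.
  move=> e _.
  apply: (L2sq_cvg (edge_range_measurable e) (F := fun k z => phi k (edge Q e z))) => //.
    by move=> k; exact: (continuous_boundary_L2 (cphi k) e).
  exact: trace_edge_cvg.
have qc : L2sq leb2 (rect_set Q) (pd1 (phi k)) + L2sq leb2 (rect_set Q) (pd2 (phi k))
    + alpha * boundary_sq (phi k) @[k --> \oo] --> q.
  by apply: cvgD; [exact: cvgD|apply: cvgM => //; exact: cvg_cst].
have mnc : (mu1 + mu2) * L2sq leb2 (rect_set Q) (phi k) @[k --> \oo] --> (mu1 + mu2) * n.
  by apply: cvgM => //; exact: cvg_cst.
split.
  apply: (ler_cvg_to mnc qc); apply: nearW => k.
  by have [] := rect_lower_C1 (C1phi k).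
have lc : Num.min (nu1 - mu1) (nu2 - mu2) * (L2sq leb2 (rect_set Q) (phi k) -
    L2dot leb2 (rect_set Q) (phi k) (product_mode X Y) ^+ 2 / N) @[k --> \oo] -->
    Num.min (nu1 - mu1) (nu2 - mu2) * (n - w ^+ 2 / N).
  apply: cvgM; first exact: cvg_cst.
  apply: cvgB => //; apply: cvgM; last exact: cvg_cst.
  by rewrite expr2; under eq_fun do rewrite expr2; exact: cvgM.
apply: (ler_cvg_to lc (cvgB qc mnc)); apply: nearW => k.
by have [] := rect_lower_C1 (C1phi k).
Qed.

End Lower.
End H1Lower.

(** * Smooth trial functions *)

Section SmoothH1.
Variable R : realType.
Local Notation leb2 := (@lebesgue2 R).
Implicit Types (phi u v : plane R -> R).

Lemma slice1_derive u (x y d : R) :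
  is_derive x 1 (fun x => u (x, y)) d -> is_derive ((x, y) : plane R) (1, 0) u d.
Proof.
move=> /is_derive_cvg h; apply/is_derive_cvg.
suff E (k : R) : k *: ((1, 0) : plane R) + (x, y) = (k%:A + x, y).
  by under eq_fun do rewrite E.
by congr pair; rewrite /= [k *: 0]mulr0 add0r.
Qed.

Lemma slice2_derive u (x y d : R) :
  is_derive y 1 (fun y => u (x, y)) d -> is_derive ((x, y) : plane R) (0, 1) u d.
Proof.
move=> /is_derive_cvg h; apply/is_derive_cvg.
suff E (k : R) : k *: ((0, 1) : plane R) + (x, y) = (x, k%:A + y).
  by under eq_fun do rewrite E.
by congr pair; rewrite /= [k *: 0]mulr0 add0r.
Qed.

Lemma C1_from_slices u (u1 u2 : plane R -> R) : continuous u -> continuous u1 -> continuous u2 ->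
  (forall x y : R, is_derive x 1 (fun x => u (x, y)) (u1 (x, y))) ->
  (forall x y : R, is_derive y 1 (fun y => u (x, y)) (u2 (x, y))) ->
  [/\ Ck 1 u, pd1 u = u1 & pd2 u = u2].
Proof.
move=> cu cu1 cu2 d1 d2.
have e1 (p : plane R) : is_derive p (1, 0) u (u1 p) by case: p => x y; exact: slice1_derive.
have e2 (p : plane R) : is_derive p (0, 1) u (u2 p) by case: p => x y; exact: slice2_derive.
have E1 : pd1 u = u1 by apply/funext => p; have [] := e1 p.
have E2 : pd2 u = u2 by apply/funext => p; have [] := e2 p.
split=> //; split=> //; split; rewrite ?E1 ?E2 //.
Qed.

(** By Fubini, integrate first in the direction of the derivative: [v] vanishes at
   both ends. *)
Lemma box_integral_pd1 (M : R) v : 0 < M -> Ck 1 v ->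
  (forall p, ~ box (- M) M (- M) M p -> v p = 0) ->
  (\int[leb2]_(p in box (- M) M (- M) M) (pd1 v p)%:E = 0)%E.
Proof.
move=> M0 C1v v0; have [cv [_ c1] _] := C1v.
rewrite box_integral21//; congr EFin.
rewrite -[RHS](mul0r (segint (- M) M (fun=> 1))) -segintZ; last by cts.
apply: eq_segint => y; rewrite mul0r.
have cs : continuous (fun x => pd1 v (x, y)).
  by apply: (cts_comp (f := fun x => (x, y)) _ c1); cts.
rewrite (segint_FTC _ cs (fun x => C1_slice1 x y C1v)); last by lra.
by rewrite !v0 ?subrr// => -[/= + _]; rewrite in_itv/= ltxx ?andbF.
Qed.

Lemma box_integral_pd2 (M : R) v : 0 < M -> Ck 1 v ->
  (forall p, ~ box (- M) M (- M) M p -> v p = 0) ->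
  (\int[leb2]_(p in box (- M) M (- M) M) (pd2 v p)%:E = 0)%E.
Proof.
move=> M0 C1v v0; have [cv _ [_ c2]] := C1v.
rewrite box_integral12//; congr EFin.
rewrite -[RHS](mul0r (segint (- M) M (fun=> 1))) -segintZ; last by cts.
apply: eq_segint => x; rewrite mul0r.
have cs : continuous (fun y => pd2 v (x, y)).
  by apply: (cts_comp (f := fun y => (x, y)) _ c2); cts.
rewrite (segint_FTC _ cs (fun y => C1_slice2 x y C1v)); last by lra.
by rewrite !v0 ?subrr// => -[/= _ +]; rewrite in_itv/= ltxx ?andbF.
Qed.

Lemma C1_mul u v : Ck 1 u -> Ck 1 v ->
  [/\ Ck 1 (fun p => u p * v p),
      pd1 (fun p => u p * v p) = (fun p => u p * pd1 v p + pd1 u p * v p) &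
      pd2 (fun p => u p * v p) = (fun p => u p * pd2 v p + pd2 u p * v p)].
Proof.
move=> hu hv; have [cu [_ cu1] [_ cu2]] := hu; have [cv [_ cv1] [_ cv2]] := hv.
move: cu1 cu2 cv1 cv2; rewrite /Ck => cu1 cu2 cv1 cv2.
apply: C1_from_slices; [by cts|by cts|by cts|move=> x y|move=> x y].
- have hu1 := C1_slice1 x y hu; have hv1 := C1_slice1 x y hv.
  by refine (der_eq (derM hu1 hv1) _); rewrite addrC.
- have hu1 := C1_slice2 x y hu; have hv1 := C1_slice2 x y hv.
  by refine (der_eq (derM hu1 hv1) _); rewrite addrC.
Qed.

Variable Q : rectangle R.

(** Integrate the derivatives of [u * phi].  They vanish off the support of [phi],
   so the rectangle can be replaced by a large square with sides parallel to the
   axes, and no boundary term appears. *)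
Lemma C1_weak_gradient u : Ck 1 u -> weak_gradient Q u (pd1 u) (pd2 u).
Proof.
move=> C1u phi [Cphi compK KQ]; have C1phi := Cphi 1%N.
set K := closure _ in compK KQ.
have [C1v pv1 pv2] := C1_mul C1u C1phi.
have phi0 p : ~ K p -> phi p = 0.
  by move=> Kp; apply: contrapT => /eqP h; apply: Kp; exact: subset_closure.
have near0 p : ~ K p -> \near p, phi p = cst 0 p.
  move=> Kp; have oK : open (~` K) by apply: closed_openC; exact: closed_closure.
  have : nbhs p (~` K) by exact: open_nbhs_nbhs.
  by apply: filterS => q; exact: phi0.
have d10 p : ~ K p -> pd1 phi p = 0.
  move=> Kp; by rewrite /pd1 (near_eq_derive _ (near0 p Kp)) derive_cst.
have d20 p : ~ K p -> pd2 phi p = 0.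
  move=> Kp; by rewrite /pd2 (near_eq_derive _ (near0 p Kp)) derive_cst.
have [M M0 KM] : exists2 M, 0 < M & K `<=` box (- M) M (- M) M.
  have [N [_ hN]] := compact_bounded compK.
  pose M := `|N| + 2; have M0 : 0 < M by rewrite ltr_wpDl.
  have NN : N < `|N| + 1 by rewrite ltr_pwDr// ler_norm.
  exists M => // -[x y] /(hN _ NN) /=.
  rewrite prod_normE/= ge_max => /andP[hx hy].
  have : `|x| < M by apply: le_lt_trans hx _; rewrite ltrD2l ltr1n.
  have : `|y| < M by apply: le_lt_trans hy _; rewrite ltrD2l ltr1n.
  by rewrite !ltr_norml => ? ?; split; rewrite /= in_itv.
have transfer (F : plane R -> R) : (forall p, ~ K p -> F p = 0) ->
    (\int[leb2]_(p in rect_set Q) (F p)%:E = \int[leb2]_(p in box (- M) M (- M) M) (F p)%:E)%E.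
  move=> F0; rewrite integral_mkcond [RHS]integral_mkcond; apply: eq_integral => p _.
  rewrite !patchE; have [Kp|/F0->] := pselect (K p); last by do 2 case: ifP.
  by rewrite !mem_set//; [exact: KM|exact: KQ].
have [cu [_ cu1] [_ cu2]] := C1u; have [cp [_ cp1] [_ cp2]] := C1phi.
move: cu1 cu2 cp1 cp2; rewrite /Ck => cu1 cu2 cp1 cp2.
have vbox p : ~ box (- M) M (- M) M p -> u p * phi p = 0.
  by move=> h; rewrite phi0 ?mulr0// => /KM.
split.
- have : (\int[leb2]_(p in rect_set Q) (pd1 (fun p => u p * phi p) p)%:E = 0)%E.
    rewrite transfer ?box_integral_pd1// => p Kp.
    by rewrite pv1 d10// phi0// !mulr0 addr0.
  rewrite pv1; under eq_integral do rewrite EFinD.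
  have i1 : leb2.-integrable (rect_set Q) (fun p => (u p * pd1 phi p)%:E).
    by apply: (@rect_integrable R Q (fun p => u p * pd1 phi p)); cts.
  have i2 : leb2.-integrable (rect_set Q) (fun p => (pd1 u p * phi p)%:E).
    by apply: (@rect_integrable R Q (fun p => pd1 u p * phi p)); cts.
  rewrite integralD//; last exact: rect_measurable.
  rewrite -(fineK (integrable_fin_num (rect_measurable Q) i1)).
  rewrite -(fineK (integrable_fin_num (rect_measurable Q) i2)) -EFinD -EFinN => -[] ab.
  by congr EFin; lra.
- have : (\int[leb2]_(p in rect_set Q) (pd2 (fun p => u p * phi p) p)%:E = 0)%E.
    rewrite transfer ?box_integral_pd2// => p Kp.
    by rewrite pv2 d20// phi0// !mulr0 addr0.
  rewrite pv2; under eq_integral do rewrite EFinD.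
  have i1 : leb2.-integrable (rect_set Q) (fun p => (u p * pd2 phi p)%:E).
    by apply: (@rect_integrable R Q (fun p => u p * pd2 phi p)); cts.
  have i2 : leb2.-integrable (rect_set Q) (fun p => (pd2 u p * phi p)%:E).
    by apply: (@rect_integrable R Q (fun p => pd2 u p * phi p)); cts.
  rewrite integralD//; last exact: rect_measurable.
  rewrite -(fineK (integrable_fin_num (rect_measurable Q) i1)).
  rewrite -(fineK (integrable_fin_num (rect_measurable Q) i2)) -EFinD -EFinN => -[] ab.
  by congr EFin; lra.
Qed.

Lemma C1_is_trace u : Ck 1 u -> is_trace Q u (pd1 u) (pd2 u) u.
Proof.
have E (F : plane R -> R) : L2_dist2 Q F F = 0%E.
  by rewrite /L2_dist2; apply: integral0_eq => p _; rewrite subrr expr0n.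
move=> C1u; exists (fun=> u); split=> //; rewrite ?E; try exact: cvg_cst.
suff -> : rect_boundary_integral Q (fun p => ((u p - u p) ^+ 2)%:E) = 0%E by exact: cvg_cst.
rewrite /rect_boundary_integral big1// => e _; apply: integral0_eq => p _.
by rewrite subrr expr0n.
Qed.

Lemma C1_H1_exists u : Ck 1 u -> exists v : H1 Q,
  [/\ h1_fun v = u, h1_d1 v = pd1 u, h1_d2 v = pd2 u & h1_trace v = u].
Proof.
move=> C1u; have [L L1 L2] := C1_L2 Q C1u; have [cu _ _] := C1u.
by exists (MkH1 L L1 L2 (continuous_boundary_L2 Q cu) (C1_weak_gradient C1u) (C1_is_trace C1u)).
Qed.

Section Products.
Variables (f df g dg : R -> R).
Hypothesis fd : forall x : R, is_derive x 1 f (df x).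
Hypothesis gd : forall x : R, is_derive x 1 g (dg x).
Hypotheses (cdf : continuous df) (cdg : continuous dg).
Let cf : continuous f. Proof. by move=> x; exact: der_cont (fd x). Qed.
Let cg : continuous g. Proof. by move=> x; exact: der_cont (gd x). Qed.
Local Notation l := (rleft Q).
Local Notation r := (rright Q).
Local Notation b := (rbottom Q).
Local Notation tp := (rtop Q).
Local Notation theta := (rangle Q).

Let u := product_mode Q f g.
Let u1 p := cos theta * product_mode Q df g p - sin theta * product_mode Q f dg p.
Let u2 p := sin theta * product_mode Q df g p + cos theta * product_mode Q f dg p.

Lemma product_C1 : [/\ Ck 1 u, pd1 u = u1 & pd2 u = u2].
Proof.
have c1 := @product_mode_continuous R Q _ _ cf cg.
have c2 := @product_mode_continuous R Q _ _ cdf cg.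
have c3 := @product_mode_continuous R Q _ _ cf cdg.
apply: C1_from_slices; [by []|by rewrite /u1; cts|by rewrite /u2; cts| |].
- move=> x y; rewrite /u /u1 /product_mode /rotation /=.
  derive_by (first [exact: fd|exact: gd]).
  by rewrite cosN sinN; ring.
- move=> x y; rewrite /u /u2 /product_mode /rotation /=.
  derive_by (first [exact: fd|exact: gd]).
  by rewrite cosN sinN; ring.
Qed.

Let F2 := segint l r (fun x => f x ^+ 2).
Let G2 := segint b tp (fun y => g y ^+ 2).

Lemma boxint_product (h k : R -> R) : continuous h -> continuous k ->
  boxint l r b tp (fun p => h p.1 * k p.2) = segint l r h * segint b tp k.
Proof.
move=> ch ck; rewrite /boxint -segintZr//.
by apply: eq_segint => x /=; rewrite segintZ.
Qed.

Lemma product_norm : L2sq leb2 (rect_set Q) u = F2 * G2.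
Proof.
have c1 := @product_mode_continuous R Q _ _ cf cg.
rewrite /L2sq /Rintegral (@rect_integral_boxint R Q (fun p => u p ^+ 2)); [|by rewrite /u; cts].
rewrite /= -boxint_product; [|by cts..].
by congr boxint; apply/funext => p; rewrite /u /product_mode rotationK exprMn.
Qed.

Lemma product_form alpha :
  L2sq leb2 (rect_set Q) (pd1 u) + L2sq leb2 (rect_set Q) (pd2 u) + alpha * boundary_sq Q u =
  (segint l r (fun x => df x ^+ 2) + alpha * (f l ^+ 2 + f r ^+ 2)) * G2 +
  (segint b tp (fun y => dg y ^+ 2) + alpha * (g b ^+ 2 + g tp ^+ 2)) * F2.
Proof.
have [[cu _ _] -> ->] := product_C1.
have c1 := @product_mode_continuous R Q _ _ cf cg.
have c2 := @product_mode_continuous R Q _ _ cdf cg.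
have c3 := @product_mode_continuous R Q _ _ cf cdg.
have cu1 : continuous u1 by rewrite /u1; cts.
have cu2 : continuous u2 by rewrite /u2; cts.
have cr := @rotation_continuous R theta.
rewrite /L2sq /Rintegral (@rect_integral_boxint R Q (fun p => u1 p ^+ 2)); [|by cts].
rewrite (@rect_integral_boxint R Q (fun p => u2 p ^+ 2)); [|by cts].
rewrite /= -boxintD; [|by cts..].
have -> : boxint l r b tp (fun p => u1 (rotation theta p) ^+ 2 + u2 (rotation theta p) ^+ 2) =
    boxint l r b tp (fun p => df p.1 ^+ 2 * g p.2 ^+ 2 + f p.1 ^+ 2 * dg p.2 ^+ 2).
  congr boxint; apply/funext => p; rewrite /u1 /u2 /product_mode rotationK.
  have := cos2Dsin2 theta; move: (cos theta) (sin theta) => c s cs.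
  by rewrite -[RHS]mul1r -cs; ring.
rewrite boxintD; [|by cts..].
rewrite (boxint_product (h := fun x => df x ^+ 2) (k := fun y => g y ^+ 2)); [|by cts..].
rewrite (boxint_product (h := fun x => f x ^+ 2) (k := fun y => dg y ^+ 2)); [|by cts..].
rewrite boundary_sq_continuous// /boundary_form /u /product_mode.
have -> : segint b tp (fun y =>
    (f (rotation (- theta) (rotation theta (l, y))).1 *
     g (rotation (- theta) (rotation theta (l, y))).2) ^+ 2 +
    (f (rotation (- theta) (rotation theta (r, y))).1 *
     g (rotation (- theta) (rotation theta (r, y))).2) ^+ 2) = (f l ^+ 2 + f r ^+ 2) * G2.
  rewrite -segintZ; last by cts.
  by apply: eq_segint => y; rewrite !rotationK /=; ring.
have -> : segint l r (fun x =>
    (f (rotation (- theta) (rotation theta (x, b))).1 *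
     g (rotation (- theta) (rotation theta (x, b))).2) ^+ 2 +
    (f (rotation (- theta) (rotation theta (x, tp))).1 *
     g (rotation (- theta) (rotation theta (x, tp))).2) ^+ 2) = (g b ^+ 2 + g tp ^+ 2) * F2.
  rewrite -segintZ; last by cts.
  by apply: eq_segint => x; rewrite !rotationK /=; ring.
rewrite -/F2 -/G2; ring.
Qed.

End Products.
End SmoothH1.

(** * Eigenvalues of a rectangle *)

Section Eigenvalues.
Variable R : realType.
Local Notation leb2 := (@lebesgue2 R).
Variables (Q : rectangle R) (alpha : R).
Local Notation D := (rect_set Q).
Local Notation l := (rleft Q).
Local Notation r := (rright Q).
Local Notation b := (rbottom Q).
Local Notation tp := (rtop Q).
Let lr : l < r := rleft_lt_rright Q.
Let bt : b < tp := rbottom_lt_rtop Q.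
Let mQ := rect_measurable Q.

(** Numerator of the Rayleigh quotient. *)
Definition robin_form (u1 u2 t : plane R -> R) : R :=
  L2sq leb2 D u1 + L2sq leb2 D u2 + alpha * boundary_sq Q t.

Lemma rayleighE k (U : 'I_k -> H1 Q) (c : 'rV[R]_k) :
  h1_data Q (lincomb c (fun i => h1_fun (U i))) (lincomb c (fun i => h1_d1 (U i)))
    (lincomb c (fun i => h1_d2 (U i))) (lincomb c (fun i => h1_trace (U i))) ->
  rayleigh alpha U c =
  robin_form (lincomb c (fun i => h1_d1 (U i))) (lincomb c (fun i => h1_d2 (U i)))
    (lincomb c (fun i => h1_trace (U i))) / L2sq leb2 D (lincomb c (fun i => h1_fun (U i))).
Proof.
move=> [[hu [mu1 hu1] [mu2 hu2]] ht _]; rewrite /rayleigh /robin_form; congr (_ / _).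
rewrite boundary_sqE//=; congr (_ + _).
under eq_integral do rewrite EFinD.
by rewrite integralD// fineD//; exact: integrable_fin_num.
Qed.

Lemma lincomb1 (c : 'rV[R]_1) (f : 'I_1 -> plane R -> R) :
  lincomb c f = fun p => c 0 0 * f 0 p + 0 * f 0 p.
Proof.
by apply/funext => p; rewrite /lincomb big_ord_recl big_ord0 mul0r.
Qed.

Lemma lincomb2 (c : 'rV[R]_2) (f : 'I_2 -> plane R -> R) :
  lincomb c f = fun p => c 0 0 * f 0 p + c 0 1 * f 1 p.
Proof.
apply/funext => p; rewrite /lincomb big_ord_recl big_ord_recl big_ord0 addr0.
by have -> : lift ord0 ord0 = 1 :> 'I_2 by exact/val_inj.
Qed.

Lemma lincomb1_data (U : 'I_1 -> H1 Q) (c : 'rV[R]_1) :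
  h1_data Q (lincomb c (fun i => h1_fun (U i))) (lincomb c (fun i => h1_d1 (U i)))
    (lincomb c (fun i => h1_d2 (U i))) (lincomb c (fun i => h1_trace (U i))).
Proof. by rewrite !lincomb1; apply: h1_data_lincomb; exact: H1_data. Qed.

Lemma lincomb2_data (U : 'I_2 -> H1 Q) (c : 'rV[R]_2) :
  h1_data Q (lincomb c (fun i => h1_fun (U i))) (lincomb c (fun i => h1_d1 (U i)))
    (lincomb c (fun i => h1_d2 (U i))) (lincomb c (fun i => h1_trace (U i))).
Proof. by rewrite !lincomb2; apply: h1_data_lincomb; exact: H1_data. Qed.

Lemma free_norm_gt0 k (U : 'I_k -> H1 Q) (c : 'rV[R]_k) :
  L2 leb2 D (lincomb c (fun i => h1_fun (U i))) -> H1_free U -> c != 0 ->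
  0 < L2sq leb2 D (lincomb c (fun i => h1_fun (U i))).
Proof.
move=> hL free c0; rewrite lt_neqAle L2sq_ge0 andbT eq_sym.
apply: contra c0 => /eqP h; apply/eqP; apply: free.
exact: (L2sq_eq0 mQ hL h).
Qed.

Lemma norm_gt0_free k (U : 'I_k -> H1 Q) :
  (forall c : 'rV[R]_k, L2 leb2 D (lincomb c (fun i => h1_fun (U i)))) ->
  (forall c : 'rV[R]_k, c != 0 -> 0 < L2sq leb2 D (lincomb c (fun i => h1_fun (U i)))) ->
  H1_free U.
Proof.
move=> hL pos c h; apply/eqP; apply: contraT => /pos.
suff -> : L2sq leb2 D (lincomb c (fun i => h1_fun (U i))) = 0 by rewrite ltxx.
apply: EFin_inj; rewrite -L2sqE//.
have [mf _] := hL c.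
have : (\int[leb2]_(p in D) `|(lincomb c (fun i => h1_fun (U i)) p ^+ 2)%:E| = 0)%E.
  apply/ae_eq_integral_abs => //; first by apply/measurable_EFinP; exact: measurable_funX.
  case: h => Z [mZ Z0 sub]; exists Z; split=> // p /= hp; apply: sub => /= h.
  by apply: hp => Dp; rewrite h// expr0n.
move=> E0; apply: etrans E0; apply: eq_integral => p _.
by rewrite gee0_abs ?lee_fin ?sqr_ge0.
Qed.

Lemma eigenvalue_ge k (lam : R) :
  (forall (U : 'I_k -> H1 Q) (c : 'rV[R]_k),
    h1_data Q (lincomb c (fun i => h1_fun (U i))) (lincomb c (fun i => h1_d1 (U i)))
      (lincomb c (fun i => h1_d2 (U i))) (lincomb c (fun i => h1_trace (U i)))) ->
  (forall U : 'I_k -> H1 Q, exists2 c : 'rV[R]_k, c != 0 &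
    lam * L2sq leb2 D (lincomb c (fun i => h1_fun (U i))) <=
    robin_form (lincomb c (fun i => h1_d1 (U i))) (lincomb c (fun i => h1_d2 (U i)))
      (lincomb c (fun i => h1_trace (U i)))) ->
  (lam%:E <= robin_eigenvalue Q alpha k)%E.
Proof.
move=> hdata h; apply: le_ereal_inf_tmp => _ [U free <-].
have [c c0 hc] := h U.
apply: (@le_trans _ _ (rayleigh alpha U c)%:E); last first.
  by apply: ereal_sup_ubound; exists c.
rewrite lee_fin rayleighE// ler_pdivlMr//.
by apply: free_norm_gt0 => //; have [[]] := hdata U c.
Qed.

Lemma eigenvalue_le k (lam : R) (U : 'I_k -> H1 Q) :
  (forall c : 'rV[R]_k,
    h1_data Q (lincomb c (fun i => h1_fun (U i))) (lincomb c (fun i => h1_d1 (U i)))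
      (lincomb c (fun i => h1_d2 (U i))) (lincomb c (fun i => h1_trace (U i)))) ->
  (forall c : 'rV[R]_k, c != 0 -> 0 < L2sq leb2 D (lincomb c (fun i => h1_fun (U i))) /\
    robin_form (lincomb c (fun i => h1_d1 (U i))) (lincomb c (fun i => h1_d2 (U i)))
      (lincomb c (fun i => h1_trace (U i))) <=
    lam * L2sq leb2 D (lincomb c (fun i => h1_fun (U i)))) ->
  (robin_eigenvalue Q alpha k <= lam%:E)%E.
Proof.
move=> hdata h; apply: (@le_trans _ _
    (ereal_sup [set (rayleigh alpha U c)%:E | c in [set c : 'rV[R]_k | c != 0]])).
  apply: ereal_inf_lbound; exists U => //=.
  apply: norm_gt0_free => c; first by have [[]] := hdata c.
  by move=> /h[].
apply: ge_ereal_sup => _ [c /= c0 <-].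
by have [n0 hc] := h c c0; rewrite lee_fin rayleighE// ler_pdivrMr.
Qed.

Lemma L2dot_lincomb (a c : R) (u v e : plane R -> R) : L2 leb2 D u -> L2 leb2 D v -> L2 leb2 D e ->
  L2dot leb2 D (fun p => a * u p + c * v p) e = a * L2dot leb2 D u e + c * L2dot leb2 D v e.
Proof.
move=> hu hv he; have iu := L2_dot_integrable mQ hu he; have iv := L2_dot_integrable mQ hv he.
rewrite /L2dot -!RintegralZl// -RintegralD//.
- by apply: eq_Rintegral => p _; ring.
- by have := integrableZl mQ a iu.
- by have := integrableZl mQ c iv.
Qed.

Section WithModes.
Variables (mu1 nu1 mu2 nu2 : R) (X dX X' dX' Y dY Y' dY' : R -> R).
Hypothesis im1 : interval_modes alpha l r mu1 nu1 X dX X' dX'.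
Hypothesis im2 : interval_modes alpha b tp mu2 nu2 Y dY Y' dY'.

Lemma first_eigenvalue_ge : ((mu1 + mu2)%:E <= robin_eigenvalue Q alpha 1)%E.
Proof.
apply: eigenvalue_ge; first exact: lincomb1_data.
move=> U; exists (const_mx 1).
  by apply/eqP => /matrixP/(_ 0 0); rewrite !mxE => /eqP; rewrite oner_eq0.
by have [] := rect_lower_H1 im1 im2 (lincomb1_data U (const_mx 1)).
Qed.

(** A plane of trial functions contains a nonzero element orthogonal to the product
   of the first modes. *)
Lemma second_eigenvalue_ge :
  ((mu1 + mu2 + Num.min (nu1 - mu1) (nu2 - mu2))%:E <= robin_eigenvalue Q alpha 2)%E.
Proof.
apply: eigenvalue_ge; first exact: lincomb2_data.
move=> U; pose e := product_mode Q X Y.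
have he : L2 leb2 D e.
  by apply: continuous_rect_L2; apply: product_mode_continuous; [exact: (im_cX im1)|exact: (im_cX im2)].
pose w i := L2dot leb2 D (h1_fun (U i)) e.
have [c c0 wc] : exists2 c : 'rV[R]_2, c != 0 & c 0 0 * w 0 + c 0 1 * w 1 = 0.
  have [w0|w0] := eqVneq (w 0) 0.
    exists (\row_j (if j == 0 then 1 else 0)).
      by apply/eqP => /matrixP/(_ 0 0); rewrite !mxE eqxx => /eqP; rewrite oner_eq0.
    by rewrite !mxE /= w0 mulr0 mul0r addr0.
  exists (\row_j (if j == 0 then - w 1 else w 0)).
    by apply/eqP => /matrixP/(_ 0 1); rewrite !mxE /= => /eqP; rewrite (negbTE w0).
  by rewrite !mxE /=; ring.
exists c => //.
have [_] := rect_lower_H1 im1 im2 (lincomb2_data U c).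
have -> : L2dot leb2 D (lincomb c (fun i => h1_fun (U i))) (product_mode Q X Y) = 0.
  by rewrite lincomb2 L2dot_lincomb//; exact: h1_fun_L2.
by rewrite expr0n mul0r subr0 /robin_form; lra.
Qed.

Lemma first_mode_form (m n s t : R) (Z dZ Z' dZ' : R -> R) : s < t ->
  interval_modes alpha s t m n Z dZ Z' dZ' ->
  segint s t (fun x => dZ x ^+ 2) + alpha * (Z s ^+ 2 + Z t ^+ 2) =
  m * segint s t (fun x => Z x ^+ 2).
Proof.
move=> st im; have := combination_form st im 1 0.
rewrite expr1n expr0n !mul0r mulr0 !addr0 !mul1r => <-.
by congr (_ + _); apply: eq_segint => x; rewrite mul1r mul0r addr0.
Qed.

Let N := segint l r (fun x => X x ^+ 2).
Let M := segint l r (fun x => X' x ^+ 2).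
Let K := segint b tp (fun y => Y y ^+ 2).
Let L := segint b tp (fun y => Y' y ^+ 2).

(** The combinations of two products that share the factor [Y] are again products,
   so that the form is computed one variable at a time. *)
Lemma trial_space1 (a c : R) :
  let u p := a * product_mode Q X Y p + c * product_mode Q X' Y p in
  [/\ Ck 1 u, L2sq leb2 D u = (a ^+ 2 * N + c ^+ 2 * M) * K &
    robin_form (pd1 u) (pd2 u) u =
    ((mu1 + mu2) * (a ^+ 2 * N) + (nu1 + mu2) * (c ^+ 2 * M)) * K].
Proof.
move=> u; pose f x := a * X x + c * X' x; pose df x := a * dX x + c * dX' x.
have -> : u = product_mode Q f Y.
  by apply/funext => p; rewrite /u /product_mode /f; ring.
have fd (x : R) : is_derive x 1 f (df x).
  rewrite /f; derive_by (first [exact: (hz_d (im_hzX im1))|exact: (hz_d (im_hzY im1))]).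
  by rewrite /df; ring.
have gd := hz_d (im_hzX im2).
have cX := im_cdX im1; have cX' := im_cdY im1; have cdY := im_cdX im2.
have cdf : continuous df by rewrite /df; cts.
have [C1 _ _] := product_C1 Q fd gd cdf cdY.
split=> //; first by rewrite (product_norm Q fd gd) (combination_norm lr im1).
rewrite /robin_form (product_form Q fd gd cdf cdY) (first_mode_form bt im2).
rewrite (combination_form lr im1) (combination_norm lr im1) -/N -/M -/K; ring.
Qed.

Lemma trial_space2 (a c : R) :
  let u p := a * product_mode Q X Y p + c * product_mode Q X Y' p in
  [/\ Ck 1 u, L2sq leb2 D u = (a ^+ 2 * K + c ^+ 2 * L) * N &
    robin_form (pd1 u) (pd2 u) u =
    ((mu1 + mu2) * (a ^+ 2 * K) + (mu1 + nu2) * (c ^+ 2 * L)) * N].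
Proof.
move=> u; pose f x := a * Y x + c * Y' x; pose df x := a * dY x + c * dY' x.
have -> : u = product_mode Q X f.
  by apply/funext => p; rewrite /u /product_mode /f; ring.
have fd (x : R) : is_derive x 1 f (df x).
  rewrite /f; derive_by (first [exact: (hz_d (im_hzX im2))|exact: (hz_d (im_hzY im2))]).
  by rewrite /df; ring.
have gd := hz_d (im_hzX im1).
have cY := im_cdX im2; have cY' := im_cdY im2; have cdX := im_cdX im1.
have cdf : continuous df by rewrite /df; cts.
have [C1 _ _] := product_C1 Q gd fd cdX cdf.
split=> //; first by rewrite (product_norm Q gd fd) (combination_norm bt im2) mulrC.
rewrite /robin_form (product_form Q gd fd cdX cdf) (first_mode_form lr im1).
rewrite (combination_form bt im2) (combination_norm bt im2) -/N -/K -/L; ring.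
Qed.

Let N0 : 0 < N. Proof. exact: (im_normX_gt0 lr im1). Qed.
Let M0 : 0 < M. Proof. exact: (im_normY_gt0 lr im1). Qed.
Let K0 : 0 < K. Proof. exact: (im_normX_gt0 bt im2). Qed.
Let L0 : 0 < L. Proof. exact: (im_normY_gt0 bt im2). Qed.

Lemma quad_gt0 (a c p q : R) : 0 < p -> 0 < q -> (a != 0) || (c != 0) ->
  0 < a ^+ 2 * p + c ^+ 2 * q.
Proof.
move=> p0 q0 ac.
have a2 : 0 <= a ^+ 2 * p by rewrite mulr_ge0 ?sqr_ge0// ltW.
have c2 : 0 <= c ^+ 2 * q by rewrite mulr_ge0 ?sqr_ge0// ltW.
rewrite lt_neqAle addr_ge0// andbT eq_sym paddr_eq0// !mulf_eq0.
by rewrite (gt_eqF p0) (gt_eqF q0) !orbF !orbb negb_and.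
Qed.

Lemma row2_neq0 (c : 'rV[R]_2) : c != 0 -> (c 0 0 != 0) || (c 0 1 != 0).
Proof.
apply: contraR; rewrite negb_or !negbK => /andP[/eqP c0 /eqP c1].
apply/eqP/rowP => i; rewrite !mxE.
have [->|->] // : i = 0 \/ i = 1.
by case: i => -[|[|//]] h; [left|right]; exact/val_inj.
Qed.

Lemma first_eigenvalue_le : (robin_eigenvalue Q alpha 1 <= (mu1 + mu2)%:E)%E.
Proof.
have [C1 _ _] := trial_space1 1 0.
set u0 := (fun p => _) in C1.
have [v [v0 v1 v2 vt]] := C1_H1_exists Q C1.
apply: (@eigenvalue_le 1 _ (fun=> v)); first by move=> c; exact: lincomb1_data.
move=> c c0.
have a0 : c 0 0 != 0.
  by apply: contra c0 => /eqP c00; apply/eqP/rowP => i; rewrite !mxE (ord1 i).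
have [C1u nE qE] := trial_space1 (c 0 0) 0.
have uE : (fun p => c 0 0 * product_mode Q X Y p + 0 * product_mode Q X' Y p) =
    (fun p => c 0 0 * u0 p + 0 * u0 p).
  by apply/funext => p; rewrite /u0; ring.
rewrite !lincomb1 v0 v1 v2 vt -pd1_lincomb// -pd2_lincomb// -uE nE qE.
have cN : 0 < c 0 0 ^+ 2 * N by apply: mulr_gt0; rewrite ?exprn_even_gt0//; exact: N0.
rewrite expr0n /= !mul0r !mulr0 !addr0; split; last by rewrite -(mulrA (mu1 + mu2)).
exact: mulr_gt0.
Qed.

Lemma second_eigenvalue_le (w0 w1 : plane R -> R) (lam : R) :
  Ck 1 w0 -> Ck 1 w1 ->
  (forall a c : R, (a != 0) || (c != 0) -> let u p := a * w0 p + c * w1 p in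
    0 < L2sq leb2 D u /\ robin_form (pd1 u) (pd2 u) u <= lam * L2sq leb2 D u) ->
  (robin_eigenvalue Q alpha 2 <= lam%:E)%E.
Proof.
move=> C0 C1 h.
have [v [v0 v1 v2 vt]] := C1_H1_exists Q C0.
have [z [z0 z1 z2 zt]] := C1_H1_exists Q C1.
apply: (@eigenvalue_le 2 _ (fun i => if i == 0 then v else z)).
  by move=> c; exact: lincomb2_data.
move=> c /row2_neq0/h; rewrite !lincomb2 /= v0 v1 v2 vt z0 z1 z2 zt.
by rewrite -pd1_lincomb// -pd2_lincomb.
Qed.

Lemma second_eigenvalue_le_min :
  (robin_eigenvalue Q alpha 2 <=
    (mu1 + mu2 + Num.min (nu1 - mu1) (nu2 - mu2))%:E)%E.
Proof.
have g1 := im_gap im1; have g2 := im_gap im2.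
have wXY : Ck 1 (product_mode Q X Y).
  have [] := trial_space1 1 0.
  suff -> : (fun p => 1 * product_mode Q X Y p + 0 * product_mode Q X' Y p) =
    product_mode Q X Y by [].
  by apply/funext => p; rewrite mul1r mul0r addr0.
have wX'Y : Ck 1 (product_mode Q X' Y).
  have [] := trial_space1 0 1.
  suff -> : (fun p => 0 * product_mode Q X Y p + 1 * product_mode Q X' Y p) =
    product_mode Q X' Y by [].
  by apply/funext => p; rewrite mul1r mul0r add0r.
have wXY' : Ck 1 (product_mode Q X Y').
  have [] := trial_space2 0 1.
  suff -> : (fun p => 0 * product_mode Q X Y p + 1 * product_mode Q X Y' p) =
    product_mode Q X Y' by [].
  by apply/funext => p; rewrite mul1r mul0r add0r.
have [_|_] := leP (nu1 - mu1) (nu2 - mu2).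
- have -> : mu1 + mu2 + (nu1 - mu1) = nu1 + mu2 by ring.
  apply: (second_eigenvalue_le wXY wX'Y) => a c ac u.
  have [_ -> ->] := trial_space1 a c.
  split; first by rewrite mulr_gt0// quad_gt0.
  rewrite [leRHS]mulrA ler_pM2r// mulrDr lerD2r ler_wpM2r ?lerD2r ?(ltW g1)//.
  by rewrite mulr_ge0 ?sqr_ge0// ltW.
- have -> : mu1 + mu2 + (nu2 - mu2) = mu1 + nu2 by ring.
  apply: (second_eigenvalue_le wXY wXY') => a c ac u.
  have [_ -> ->] := trial_space2 a c.
  split; first by rewrite mulr_gt0// quad_gt0.
  rewrite [leRHS]mulrA ler_pM2r// mulrDr lerD2r ler_wpM2r ?lerD2l ?(ltW g2)//.
  by rewrite mulr_ge0 ?sqr_ge0// ltW.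
Qed.

Lemma rectangle_eigenvalues :
  robin_eigenvalue Q alpha 1 = (mu1 + mu2)%:E /\
  robin_eigenvalue Q alpha 2 = (mu1 + mu2 + Num.min (nu1 - mu1) (nu2 - mu2))%:E.
Proof.
split; apply/eqP; rewrite eq_le.
  by rewrite first_eigenvalue_le first_eigenvalue_ge.
by rewrite second_eigenvalue_le_min second_eigenvalue_ge.
Qed.

End WithModes.
End Eigenvalues.

(** * Congruence of rectangles *)

Section Congruence.
Variable R : realType.
Implicit Types (A B C : set (plane R)).

Lemma congruent_trans A B C : congruent A B -> congruent B C -> congruent A C.
Proof.
move=> [f [fi fA]] [g [gi gB]]; exists (fun p => g (f p)); split.
  by move=> p q; rewrite gi fi.
by rewrite -gB -fA -image_comp.
Qed.

Lemma rotation_edist (theta : R) (p q : plane R) :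
  Defs.edist (rotation theta p) (rotation theta q) = Defs.edist p q.
Proof.
rewrite /Defs.edist /rotation /=; congr Num.sqrt; have := cos2Dsin2 theta.
by move: (cos _) (sin _) => c s cs; rewrite -[RHS]mul1r -cs; ring.
Qed.

Lemma congruent_rotation (theta : R) A : congruent A (rotation theta @` A).
Proof. by exists (rotation theta); split=> //; exact: rotation_edist. Qed.

Lemma congruent_rotationN (theta : R) A : congruent (rotation theta @` A) A.
Proof.
exists (rotation (- theta)); split; first exact: rotation_edist.
by rewrite image_comp -[RHS]image_id; apply: eq_imagel => p _ /=; rewrite rotationK.
Qed.

Lemma congruent_translate (l r b t l' r' b' t' : R) :
  r - l = r' - l' -> t - b = t' - b' -> congruent (box l r b t) (box l' r' b' t').
Proof.
move=> h1 h2; exists (fun p => (p.1 + (l' - l), p.2 + (b' - b))); split.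
  by move=> p q; rewrite /Defs.edist /=; congr Num.sqrt; ring.
apply/seteqP; split=> [_ [[x y] [/= + +] <-]|[x y] [/=]]; rewrite !in_itv/=.
  by move=> /andP[? ?] /andP[? ?]; split; rewrite /= in_itv/=; apply/andP; split; lra.
move=> /andP[? ?] /andP[? ?]; exists (x - (l' - l), y - (b' - b)).
  by split; rewrite /= in_itv/=; apply/andP; split; lra.
by rewrite /= !subrK.
Qed.

Lemma congruent_swap (l r b t : R) : congruent (box l r b t) (box b t l r).
Proof.
exists (fun p => (p.2, p.1)); split.
  by move=> p q; rewrite /Defs.edist /= addrC.
by apply/seteqP; split=> [_ [[x y] [/= ? ?] <-]//|[x y] [/= ? ?]]; exists (y, x).
Qed.

Lemma rect_congruent (Q Q' : rectangle R) :
  congruent (box (rleft Q) (rright Q) (rbottom Q) (rtop Q))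
    (box (rleft Q') (rright Q') (rbottom Q') (rtop Q')) ->
  congruent (rect_set Q) (rect_set Q').
Proof.
move=> h; apply: congruent_trans (congruent_rotationN _ _) _.
exact: congruent_trans h (congruent_rotation _ _).
Qed.

End Congruence.

(** As [gam] is decreasing, the minimum is its value at the longer side, which it
   determines; the sum then determines the other one. *)
Lemma sides_determined (R : realType) (mu gam : R -> R) (c d c' d' : R) :
  (forall x y, 0 < x -> x < y -> gam y < gam x) ->
  (forall x y, 0 < x -> x < y -> mu x != mu y) ->
  0 < c -> 0 < d -> 0 < c' -> 0 < d' ->
  mu c + mu d = mu c' + mu d' ->
  Num.min (gam c) (gam d) = Num.min (gam c') (gam d') ->
  (c = c' /\ d = d') \/ (c = d' /\ d = c').
Proof.
move=> gdec minj.
have ginj x y : 0 < x -> 0 < y -> gam x = gam y -> x = y.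
  move=> x0 y0 e; have [h|h|//] := ltgtP x y.
    by have := gdec _ _ x0 h; rewrite e ltxx.
  by have := gdec _ _ y0 h; rewrite e ltxx.
have muinj x y : 0 < x -> 0 < y -> mu x = mu y -> x = y.
  move=> x0 y0 e; have [h|h|//] := ltgtP x y.
    by have := minj _ _ x0 h; rewrite e eqxx.
  by have := minj _ _ y0 h; rewrite e eqxx.
move=> c0 d0 c'0 d'0 e1.
have [_|_] := leP (gam c) (gam d); have [_|_] := leP (gam c') (gam d') => e2.
- have e := ginj _ _ c0 c'0 e2; left; split=> //.
  by apply: muinj => //; move: e1; rewrite e => /addrI.
- have e := ginj _ _ c0 d'0 e2; right; split=> //.
  by apply: muinj => //; move: e1; rewrite e [RHS]addrC => /addrI.
- have e := ginj _ _ d0 c'0 e2; right; split=> //.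
  by apply: muinj => //; move: e1; rewrite e addrC => /addrI.
- have e := ginj _ _ d0 d'0 e2; left; split=> //.
  by apply: muinj => //; move: e1; rewrite e => /addIr.
Qed.

Theorem theorem3p12 (R : realType) (alpha : R) (alpha_neq0 : alpha != 0)
  (Q Q' : rectangle R)
  (eq_lambda1 : robin_eigenvalue Q alpha 1 = robin_eigenvalue Q' alpha 1)
  (eq_lambda2 : robin_eigenvalue Q alpha 2 = robin_eigenvalue Q' alpha 2) :
  congruent (rect_set Q) (rect_set Q').
Proof.
have [mu [nu [X [dX [Y [dY hm]]]]]] := robin_spectrum_interval alpha_neq0.
pose gam c := nu c - mu c.
have eig (P : rectangle R) : let c := (rright P - rleft P) / 2 in
    let d := (rtop P - rbottom P) / 2 in
    [/\ 0 < c, 0 < d, robin_eigenvalue P alpha 1 = (mu c + mu d)%:E &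
      robin_eigenvalue P alpha 2 = (mu c + mu d + Num.min (gam c) (gam d))%:E].
  move=> c d; have lr := rleft_lt_rright P; have bt := rbottom_lt_rtop P.
  have c0 : 0 < c by rewrite /c; lra.
  have d0 : 0 < d by rewrite /d; lra.
  have [e1 o1] := hm _ c0; have [e2 o2] := hm _ d0.
  have [h1 h2] := rectangle_eigenvalues (interval_modes_translate lr e1 o1)
    (interval_modes_translate bt e2 o2).
  by split.
have [c0 d0 l1 l2] := eig Q; have [c'0 d'0 l1' l2'] := eig Q'.
move: eq_lambda1 eq_lambda2; rewrite l1 l1' l2 l2' => -[E1] [E2].
rewrite E1 in E2; move/addrI: E2 => E2.
have gdec x y : 0 < x -> x < y -> gam y < gam x.
  move=> x0 xy; have [ex ox] := hm _ x0; have [ey oy] := hm _ (lt_trans x0 xy).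
  exact: (gap_lt alpha_neq0 x0 xy ex ox ey oy).
have minj x y : 0 < x -> x < y -> mu x != mu y.
  move=> x0 xy; have [ex _] := hm _ x0; have [ey _] := hm _ (lt_trans x0 xy).
  have [hp hn] := even_mode_lt x0 xy ex ey.
  by move: alpha_neq0; case: ltgtP => // [/hn|/hp] h _; [rewrite lt_eqF|rewrite gt_eqF].
have [[h1 h2]|[h1 h2]] := sides_determined gdec minj c0 d0 c'0 d'0 E1 E2; apply: rect_congruent.
- by apply: congruent_translate; lra.
- apply: congruent_trans (congruent_swap _ _ _ _) _.
  by apply: congruent_translate; lra.
Qed.
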